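(* Assume $\sigma\le\gamma\mu_1$ and $\sigma\le\gamma(1-\mu_1)$. Define $p(u):=(1+u)^{\gamma}-1-u^{\gamma}$ and $q(u):=1+u^{\gamma}$. The growth rate $g(\sigma,\mu_1)$ for the ensemble $\mathrm{E}(n,\gamma,\delta)$ is given as $$g(\sigma,\mu_1)=H_2(\sigma)-\gamma\frac{\delta-1}{\delta}H_2(\mu_1)+\inf_{u>0}\bigl\{\sigma\log p(u)+(1-\sigma)\log q(u)-\mu_1\gamma\log u\bigr\}.$$ A point $u$ achieving the infimum satisfies $$\sigma\,u\,p'(u)q(u)+(1-\sigma)\,u\,p(u)q'(u)=\mu_1\gamma\,p(u)q(u),$$ where $p':=\frac{dp}{du}$ and $q':=\frac{dq}{du}$.
   Context: Logarithms are base 2, and $H_2(x)=-x\log x-(1-x)\log(1-x)$ is the binary entropy function. Ensemble $\mathrm{E}(n,\gamma,\delta)$: there are $n$ variable nodes of degree $\gamma$ and $m$ check nodes of degree $\delta$, with $\xi:=\gamma n=\delta m$ edges. A node of degree $i$ has $i$ sockets. For a permutation $\pi$ of $\{1,\dots,\xi\}$, the $i$-th socket on the variable node side is joined to the $\pi(i)$-th socket on the check node side; all $\xi!$ permutations are equally likely. Each resulting bipartite graph is regarded as a hypergraph $\mathcal{H}$ whose $m$ vertices are the check nodes and whose $n$ nets (hyperedges) are the variable nodes; a vertex belongs to a net iff the corresponding nodes are connected. A bipartition $\Pi_2=(\mathcal{U}_1,\mathcal{U}_2)$ of $\mathcal{H}$ consists of two non-empty disjoint vertex sets whose union is the whole vertex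 set. A net is cut if it contains vertices of both parts, and the cutsize of $\Pi_2$ is the number of cut nets. The cutsize distribution $A(s,m_1)$ is the average, over the $\xi!$ permutations, of the number of bipartitions with cutsize $s$ and $|\mathcal{U}_1|=m_1$. The growth rate is $g(\sigma,\mu_1)=\lim_{n\to\infty}\frac1n\log A(\sigma n,\mu_1 m)$, so that $\sigma$ is the ratio of the cutsize to $n$ and $\mu_1$ is the ratio of $|\mathcal{U}_1|$ to $m$.
   Formalization: The limit defining g is taken over those n for which m, σn and μ1m are integers and A(σn, μ1m) is nonzero; otherwise it can fail to exist (e.g. γ=δ=2, σ=μ1=1/2, where A=0 for n≡2 mod 4). *)

(* Defs.v *)
From HB Require Import structures.
From mathcomp Require Import all_boot all_order all_algebra perm.
Set Implicit Arguments.
Unset Strict Implicit.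
Unset Printing Implicit Defensive.

Section Hypergraph.
Variables (n m : nat) (net : 'I_n -> {set 'I_m}).

Definition is_bipartition (P : {set 'I_m} * {set 'I_m}) : bool :=
  [&& P.1 != set0, P.2 != set0, [disjoint P.1 & P.2]
    & P.1 :|: P.2 == [set: 'I_m]].

Definition is_cut (P : {set 'I_m} * {set 'I_m}) (j : 'I_n) : bool :=
  [exists v, v \in (net j :&: P.1)] && [exists v, v \in (net j :&: P.2)].

Definition cutsize (P : {set 'I_m} * {set 'I_m}) : nat :=
  #|[set j | is_cut P j]|.

(* Bipartitions are ordered pairs: (U1, U2) and (U2, U1) are distinct. *)
Definition nb_bipartitions (s m1 : nat) : nat :=
  #|[set P | [&& is_bipartition P, cutsize P == s & #|P.1| == m1]]|.

End Hypergraph.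

(* Sockets are numbered from 0, node by node: socket [i] on the variable side
   belongs to variable node [i %/ gamma], and socket [k] on the check side to
   check node [k %/ delta].  Parallel edges are allowed. *)
Definition connected_nodes (n m gamma delta : nat) (pi : 'S_(gamma * n))
    (j : 'I_n) (v : 'I_m) : bool :=
  [exists i : 'I_(gamma * n),
     (i %/ gamma == j :> nat)%N && (pi i %/ delta == v :> nat)%N].

Definition nets (n m gamma delta : nat) (pi : 'S_(gamma * n)) (j : 'I_n) :
    {set 'I_m} :=
  [set v | connected_nodes delta pi j v].

From mathcomp Require Import all_classical all_reals all_analysis.
Import Order.TTheory GRing.Theory Num.Theory.
Import numFieldNormedType.Exports.
Local Open Scope classical_set_scope.
Local Open Scope ring_scope.

Definition log2 {R : realType} (x : R) : R := ln x / ln 2.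

(* Since [ln 0 = 0], the convention 0 log 0 = 0 holds at x = 0 and x = 1. *)
Definition H2 {R : realType} (x : R) : R :=
  - x * log2 x - (1 - x) * log2 (1 - x).

(* Meaningful when [gamma * n = delta * m]. *)
Definition cutsize_distribution (R : realType) (gamma delta n m s m1 : nat) : R :=
  (\sum_(pi : 'S_(gamma * n)) nb_bipartitions (@nets n m gamma delta pi) s m1)%N%:R
  / ((gamma * n)`!)%:R.

Definition nb_checks (gamma delta n : nat) : nat := (gamma * n %/ delta)%N.

(* A(sigma n, mu1 m); the truncations are exact on [growth_domain]. *)
Definition scaled_distribution {R : realType} (gamma delta : nat) (sigma mu1 : R)
    (n : nat) : R :=
  let m := nb_checks gamma delta n in
  cutsize_distribution R gamma delta n m
    (Num.truncn (sigma * n%:R)) (Num.truncn (mu1 * m%:R)).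

(* The lengths [n] for which log A(sigma n, mu1 m) is defined: the ensemble
   exists, the arguments of A are natural numbers, and A does not vanish.  The
   last condition matters: for gamma = 2, or for sigma = 0, A vanishes at
   infinitely many otherwise suitable lengths, by a parity (resp. divisibility)
   obstruction. *)
Definition growth_domain {R : realType} (gamma delta : nat) (sigma mu1 : R) :
    set nat :=
  [set n | [/\ (delta %| gamma * n)%N,
               sigma * n%:R \is a Num.nat,
               mu1 * (nb_checks gamma delta n)%:R \is a Num.nat &
               scaled_distribution gamma delta sigma mu1 n != 0]].

Definition is_growth_rate {R : realType} (gamma delta : nat) (sigma mu1 g : R) :
    Prop :=
  (n%:R)^-1 * log2 (scaled_distribution gamma delta sigma mu1 n)
    @[n --> within (growth_domain gamma delta sigma mu1) \oo] --> g.

Definition pfun {R : realType} (gamma : nat) (u : R) : R :=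
  (1 + u) ^+ gamma - 1 - u ^+ gamma.

Definition qfun {R : realType} (gamma : nat) (u : R) : R := 1 + u ^+ gamma.

Definition objective {R : realType} (gamma : nat) (sigma mu1 u : R) : R :=
  sigma * log2 (pfun gamma u) + (1 - sigma) * log2 (qfun gamma u)
  - mu1 * gamma%:R * log2 u.

(* Main.v *)
(* Fix one part [U1] of the bipartition.  A uniform permutation pulls its
   sockets back to a uniform set of [k = delta m1] variable sockets, so that,
   with [F = p^s q^(n - s)] and [F_k] its coefficient of degree [k],
     [A(s, m1) = C(m, m1) C(n, s) F_k / C(gamma n, k)].
   The binomials contribute the entropies.  For every [u > 0] the upper bound
   [F_k <= F(u) u^(- k)] holds because the coefficients are nonnegative.  For
   the lower bound take [u] minimising the objective: the stationarity equation
   says that the random exponent with weights [F_i u^i / F(u)] has mean exactly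
   [k], and its variance is O(n), so by Chebyshev half of [F(u)] is carried by
   the exponents within O(sqrt n) of [k].  Consecutive nonzero coefficients of
   [F] have ratio O(n), whence [F_k u^k >= F(u) exp(- O(sqrt n log n))].  When
   [sigma] equals [gamma mu1] or [gamma (1 - mu1)] there is no minimiser, but
   then [F_k >= gamma^s], which is the limit of the objective at 0, resp. at
   infinity. *)
Require Import Defs.
From HB Require Import structures.
From mathcomp Require Import all_boot all_order all_algebra perm.
From mathcomp Require Import fingroup action primitive_action alt.
From mathcomp Require Import zify ring lra.
Set Implicit Arguments.
Unset Strict Implicit.
Unset Printing Implicit Defensive.
Import Order.TTheory GRing.Theory Num.Theory.

(** * The cutsize distribution as a coefficient *)

(** The symmetric group is [#|A|]-transitive; apply this to enumerations of [A] and [B]. *)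
Lemma perm_onto_set (T : finType) (A B : {set T}) :
  #|A| = #|B| -> exists r : {perm T}, r @: A = B.
Proof.
move=> cAB.
have tr : ntransitive #|A| (Sym T) [set: T] (perm_action T).
  exact: ntransitive_weak (max_card _) (Sym_trans T).
have sB : size (enum B) == #|A| by rewrite -cardE cAB.
have dA : enum_tuple A \in dtuple_on #|A| [set: T].
  by rewrite inE enum_uniq; apply/subsetP => x; rewrite inE.
have dB : Tuple sB \in dtuple_on #|A| [set: T].
  by rewrite inE enum_uniq; apply/subsetP => x; rewrite inE.
have [r _ /(congr1 val) /= rAB] := atransP2 tr dA dB.
exists r; apply/setP => y; rewrite -[RHS]mem_enum rAB.
apply/imsetP/mapP => -[x xA ->]; exists x; rewrite ?mem_enum // in xA *.
Qed.

(** The number of permutations pulling [S] back to [A] is the same for every [A] of size [#|S|], so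
    a uniform permutation pulls [S] back to a uniform set of that size. *)
Lemma card_perm_preimset (T : finType) (S : {set T}) (P : pred {set T}) :
  (#|[set r : {perm T} | P (r @^-1: S)]| * 'C(#|T|, #|S|) =
   #|[set A : {set T} | P A & #|A| == #|S|]| * #|T|`!)%N.
Proof.
pose c (A : {set T}) := #|[set r : {perm T} | r @^-1: S == A]|.
have cS (A : {set T}) : #|A| = #|S| -> c A = c S.
  move=> /perm_onto_set [t tA]; rewrite /c.
  have tS (u r : {perm T}) : (u * r)%g @^-1: S = u @^-1: (r @^-1: S).
    by apply/setP => x; rewrite !inE permM.
  have tSA : t @^-1: S = A.
    by apply/setP => x; rewrite inE -tA mem_imset //; exact: perm_inj.
  (* Left multiplication by [t] carries the permutations stabilising [S] onto those pulling [S] back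
     to [A]. *)
  rewrite -[RHS](card_imset _ (mulgI t)); congr #|pred_of_set _|.
  apply/setP => r; apply/idP/imsetP => [|[r' + ->]];
    rewrite !inE => /eqP rA; last by rewrite tS rA tSA.
  exists (t^-1 * r)%g; last by rewrite mulgA mulgV mul1g.
  by rewrite inE tS rA -tSA; apply/eqP/setP => x; rewrite !inE permKV.
have count (Q : pred {set T}) : #|[set r : {perm T} | Q (r @^-1: S)]| =
    (#|[set A : {set T} | Q A & #|A| == #|S|]| * c S)%N.
  rewrite -sum1_card.
  rewrite (partition_big (fun r : {perm T} => r @^-1: S)
    [in [set A : {set T} | Q A & #|A| == #|S|]]) /=;
  last first.
    by move=> r; rewrite !inE => ->; rewrite card_preimset ?eqxx //; exact: perm_inj.
  rewrite -sum_nat_const; apply: eq_bigr => A; rewrite inE => /andP[QA /eqP cA].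
  rewrite sum1_card -(cS _ cA) /c; apply: eq_card => r; rewrite !inE.
  rewrite unfold_in /= inE; case: eqP => [->|]; rewrite ?QA ?andbF ?andbT //.
(* The trivial predicate counts all permutations and so determines [c S]. *)
have := count xpredT; rewrite count.
have -> : #|[set r : {perm T} | xpredT (r @^-1: S)]| = #|T|`!.
  by rewrite -(card_Sym T); apply: eq_card => r; rewrite !inE.
by move=> ->; rewrite mulnAC -mulnA card_draws.
Qed.

Local Open Scope ring_scope.

(** * Nodes and their sockets *)

Section Sockets.
Variables (m d N : nat) (mdN : (m * d = N)%N).

Lemma socket_subproof (x : 'I_m * 'I_d) : (x.1 * d + x.2 < N)%N.
Proof.
case: x => -[i i_m] [b b_d] /=.
by rewrite -mdN (leq_trans (_ : _ < i.+1 * d)%N) ?leq_mul2r ?i_m ?orbT // mulSn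
           addnC ltn_add2r.
Qed.

(** The equation [mdN] is a hypothesis so that the sockets of both sides, [gamma] per variable node
    and [delta] per check node, live in the same type ['I_(gamma * n)]. *)
Definition socket (x : 'I_m * 'I_d) : 'I_N := Ordinal (socket_subproof x).

Lemma socket_div (x : 'I_m * 'I_d) : (socket x %/ d)%N = x.1.
Proof.
case: x => i [b b_d] /=.
by rewrite divnMDl ?(leq_ltn_trans _ b_d) // divn_small ?addn0.
Qed.

Lemma socket_inj : injective socket.
Proof.
move=> x y xy; have x1y1 : x.1 = y.1.
  by apply: val_inj; rewrite /= -socket_div xy socket_div.
case: x y xy x1y1 => [i b] [j c] /= xy ij; subst j.
have /addnI bc := congr1 val xy.
by congr (_, _); apply: val_inj.
Qed.

Lemma socketP (k : 'I_N) : exists x, k = socket x.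
Proof.
have d_gt0 : (0 < d)%N.
  by case: d mdN k => //; rewrite muln0 => <- -[].
have q_m : (k %/ d < m)%N by rewrite ltn_divLR // mdN.
exists (Ordinal q_m, Ordinal (ltn_pmod k d_gt0)).
by apply: val_inj; rewrite /= -divn_eq.
Qed.

Lemma card_socket_preim (U : {set 'I_m}) :
  #|[set k : 'I_N | [exists v in U, k %/ d == v]%N]| = (#|U| * d)%N.
Proof.
rewrite -[d in RHS]card_ord -[#|'I_d|]cardsT -cardsX -(card_imset _ socket_inj).
apply: eq_card => k; rewrite inE.
apply/exists_inP/imsetP => [[v vU /eqP kv]|[x]].
  have [x kx] := socketP k; exists x => //; rewrite !inE andbT.
  by move: kv; rewrite kx socket_div => /val_inj ->.
by rewrite !inE andbT => x1U ->; exists x.1; rewrite ?socket_div.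
Qed.

Definition block (T : {set 'I_N}) (j : 'I_m) : {set 'I_d} :=
  [set b | socket (j, b) \in T].

Definition blocks (T : {set 'I_N}) : {ffun 'I_m -> {set 'I_d}} :=
  [ffun j => block T j].

(** A set of sockets amounts to an independent choice of a subset at each node; this turns the count
    into a product. *)
Lemma blocks_bij : bijective blocks.
Proof.
exists (fun f : {ffun 'I_m -> {set 'I_d}} =>
  [set socket x | x in [pred x | x.2 \in f x.1]]) => [T|f].
  apply/setP => k; have [[j b] ->] := socketP k.
  by rewrite mem_imset ?inE ?ffunE ?inE //; exact: socket_inj.
apply/ffunP => j; apply/setP => b; rewrite ffunE inE.
by rewrite mem_imset ?inE //; exact: socket_inj.
Qed.

Lemma card_blocks (T : {set 'I_N}) : #|T| = (\sum_j #|blocks T j|)%N.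
Proof.
rewrite -sum1_card.
rewrite (reindex socket) /=; last first.
  by apply: onW_bij; apply: inj_card_bij; [exact: socket_inj|
    rewrite card_prod !card_ord mdN].
rewrite big_mkcond; symmetry.
under eq_bigr => j _ do rewrite ffunE -sum1_card big_mkcond /=.
by rewrite pair_bigA /=; apply: eq_bigr => -[j b] _; rewrite inE.
Qed.

End Sockets.

(** Meant for the sockets of one net that lead into the first part: the net is cut exactly when
    these are neither none nor all. *)
Definition proper_part (T : finType) (B : {set T}) :=
  (B != set0) && (B != [set: T]).

(** * Generating functions of cut and uncut nets *)

Section CutPoly.
Variable R : comNzRingType.
Implicit Types (d : nat).

(** These are [q] and [p] of the theorem, seen for [d > 0] as size generating functions of the
    subsets of [d] sockets that leave a net uncut, resp. cut it. *)
Definition uncut_poly d : {poly R} := 1 + 'X^d.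
Definition cut_poly d : {poly R} := (1 + 'X) ^+ d - uncut_poly d.

Lemma sum_uncut d : (0 < d)%N ->
  \sum_(B : {set 'I_d} | ~~ proper_part B) 'X^#|B| = uncut_poly d.
Proof.
move=> d_gt0; have T0 : [set: 'I_d] != set0.
  by rewrite -card_gt0 cardsT card_ord.
rewrite (bigD1 set0) /=; last by rewrite /proper_part eqxx.
rewrite (bigD1 [set: 'I_d]) /=; last by rewrite /proper_part T0 eqxx andbF.
rewrite cards0 expr0 cardsT card_ord big1 ?addr0 // => B.
by rewrite /proper_part; case: (B == set0); case: (B == setT).
Qed.

Lemma sum_cut d : (0 < d)%N ->
  \sum_(B : {set 'I_d} | proper_part B) 'X^#|B| = cut_poly d.
Proof.
move=> d_gt0; rewrite /cut_poly -sum_uncut //; apply/(canRL (addrK _)).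
transitivity (\sum_(B : {set 'I_d}) 'X^#|B| : {poly R}).
  by rewrite [RHS](bigID (@proper_part _)).
rewrite [1 + 'X]addrC -[X in _ ^+ X]card_ord -prodr_const bigA_distr.
by apply: eq_bigr => B _; rewrite -prodr_const big_mkcond.
Qed.

Section Count.
Variables (n d N : nat) (ndN : (n * d = N)%N).

Definition cut_blocks (T : {set 'I_N}) : {set 'I_n} :=
  [set j | proper_part (block ndN T j)].

(** Sort the socket sets by the set [J] of nodes they cut: each node in [J] contributes a factor
    [p], each other node a factor [q], and the binomial counts the choices of [J]. *)
Lemma sum_cut_blocks s : (0 < d)%N ->
  \sum_(T : {set 'I_N} | #|cut_blocks T| == s) 'X^#|T| =
  (cut_poly d ^+ s * uncut_poly d ^+ (n - s)) *+ 'C(n, s).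
Proof.
move=> d_gt0.
rewrite (partition_big cut_blocks (fun J => #|J| == s)) //=.
rewrite -[in X in _ *+ X](card_ord n) -card_draws -sumr_const.
rewrite [RHS](eq_bigl (fun J : {set 'I_n} => #|J| == s)); last first.
  by move=> J; rewrite inE.
apply: eq_bigr => J /eqP Js.
pose Q (j : 'I_n) (B : {set 'I_d}) := proper_part B == (j \in J).
transitivity (\sum_(f in family Q) \prod_j 'X^#|f j| : {poly R}).
  rewrite (reindex (blocks ndN)) /=; last exact: onW_bij (blocks_bij ndN).
  apply: eq_big => [T|T _]; last by rewrite (card_blocks ndN) -expr_sum.
  have -> : (#|cut_blocks T| == s) && (cut_blocks T == J) = (cut_blocks T == J).
    by case: (cut_blocks T =P J) => [->|]; rewrite ?andbF // Js eqxx.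
  apply/eqP/familyP => [cJ j|bQ].
    by rewrite unfold_in /Q -cJ inE ffunE.
  by apply/setP => j; rewrite inE -(eqP (bQ j)) ffunE.
rewrite -(bigA_distr_big_dep _ (fun i (B : {set 'I_d}) => 'X^#|B|)).
rewrite (bigID [in J]) /=; congr (_ * _).
  rewrite -sum_cut // -Js -prodr_const; apply: eq_bigr => j jJ.
  by apply: eq_bigl => B; rewrite /Q jJ eqb_id.
rewrite -sum_uncut //; have -> : (n - s)%N = #|~: J|.
  by rewrite -Js [in RHS]cardsCs setCK card_ord.
rewrite -prodr_const; apply: eq_big => j; first by rewrite inE.
by move=> jJ; apply: eq_bigl => B; rewrite /Q (negPf jJ) eqbF_neg.
Qed.

End Count.
End CutPoly.

(** * Averaging over the ensemble *)

Section Ensemble.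
Variables (n m gamma delta : nat).
Hypotheses (hg : (n * gamma = gamma * n)%N) (hd : (m * delta = gamma * n)%N).

Definition part_sockets (U : {set 'I_m}) : {set 'I_(gamma * n)} :=
  [set k : 'I_(gamma * n) | [exists v in U, k %/ delta == v]%N].

Lemma part_socketsC (U : {set 'I_m}) : part_sockets (~: U) = ~: part_sockets U.
Proof.
apply/setP => k; rewrite !inE; have [[v b] ->] := socketP hd k.
rewrite socket_div /=; apply/exists_inP/idP => [[w]|vU].
  rewrite inE => wU /eqP vw; apply/exists_inP => -[x xU /eqP vx].
  by move: wU; rewrite -(val_inj vw) (val_inj vx) xU.
exists v => //; rewrite inE; apply: contra vU => vU.
by apply/exists_inP; exists v.
Qed.

Lemma nets_meet (pi : 'S_(gamma * n)) (U : {set 'I_m}) (j : 'I_n) :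
  [exists v, v \in @nets n m gamma delta pi j :&: U] =
  (block hg (pi @^-1: part_sockets U) j != set0).
Proof.
apply/existsP/set0Pn => [[v]|[b]].
  rewrite !inE => /andP[/existsP[i /andP[/eqP ij /eqP iv]] vU].
  have [[j' b] ib] := socketP hg i; exists b; rewrite !inE.
  have jj : j' = j by apply: val_inj; rewrite /= -ij ib socket_div.
  by apply/exists_inP; exists v => //; rewrite -iv ib jj.
rewrite !inE => /exists_inP[v vU /eqP bv]; exists v; rewrite !inE vU andbT.
by apply/existsP; exists (socket hg (j, b)); rewrite socket_div bv !eqxx.
Qed.

Lemma cutsizeE (pi : 'S_(gamma * n)) (U : {set 'I_m}) :
  cutsize (@nets n m gamma delta pi) (U, ~: U) =
  #|cut_blocks hg (pi @^-1: part_sockets U)|.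
Proof.
apply: eq_card => j; rewrite !inE /is_cut /= !nets_meet part_socketsC.
congr (_ && _); set A := _ @^-1: part_sockets U.
have -> : block hg (pi @^-1: (~: part_sockets U)) j = ~: block hg A j.
  by apply/setP => b; rewrite !inE.
by rewrite -(inj_eq (@setC_inj _)) setCK setC0.
Qed.

(** The second part is the complement of the first, and [0 < m1 < m] makes both non-empty. *)
Lemma nb_bipartitionsE (net : 'I_n -> {set 'I_m}) s m1 : (0 < m1 < m)%N ->
  nb_bipartitions net s m1 =
  (\sum_(U : {set 'I_m} | #|U| == m1) (cutsize net (U, ~: U) == s))%N.
Proof.
move=> /andP[m1_gt0 m1_m].
rewrite -big_mkcondr sum1_card /nb_bipartitions.
pose f (U : {set 'I_m}) := (U, ~: U).
rewrite -(card_imset (f := f)) => [|U V [] //].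
apply: eq_card => -[U V]; rewrite inE /is_bipartition /=.
apply/idP/imsetP => [/and3P[/and4P[_ _ dUV /eqP UV] cUV cU]|[U' + [-> ->]]].
  suff VE : V = ~: U by exists U; rewrite ?VE // unfold_in cU -VE.
  apply/setP => x; rewrite inE; move/setP/(_ x): UV; rewrite !inE.
  by case xU: (x \in U) => //= _; rewrite (disjointFr dUV xU).
rewrite unfold_in => /andP[/eqP cU -> ]; rewrite cU eqxx setUCr eqxx andbT.
have cC : #|~: U'| = (m - m1)%N by rewrite cardsCs setCK card_ord cU.
by rewrite -!card_gt0 cU cC subn_gt0 m1_gt0 m1_m disjoints_subset setCK subxx.
Qed.

(** Exchange the two sums: by [card_perm_preimset], every part [U] of size [m1] contributes the same
    count. *)
Lemma sum_nb_bipartitions s m1 : (0 < m1 < m)%N ->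
  ((\sum_(pi : 'S_(gamma * n)) nb_bipartitions (@nets n m gamma delta pi) s m1) *
     'C(gamma * n, m1 * delta) =
   'C(m, m1) * #|[set T | #|cut_blocks hg T| == s & #|T| == m1 * delta]| *
     (gamma * n)`!)%N.
Proof.
move=> m1m; under eq_bigr => pi _ do rewrite nb_bipartitionsE //.
have -> : 'C(m, m1) = (\sum_(U : {set 'I_m} | #|U| == m1) 1)%N.
  by rewrite -[m in LHS]card_ord -card_draws -sum1_card; apply: eq_bigl => U;
     rewrite inE.
rewrite exchange_big /= !big_distrl /=.
apply: eq_bigr => U /eqP cU; rewrite mul1n.
have cS : #|part_sockets U| = (m1 * delta)%N by rewrite -cU -(card_socket_preim hd).
have := card_perm_preimset (part_sockets U) (fun T => #|cut_blocks hg T| == s).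
rewrite cS card_ord => <-; congr (_ * _)%N.
rewrite -big_mkcond sum1_card; apply: eq_card => pi.
by rewrite inE unfold_in cutsizeE.
Qed.

End Ensemble.

(** * Neighbouring coefficients of [p^s q^t] *)

Section CoefOrder.
Variable R : numDomainType.
Implicit Types (P Q A B L M N : {poly R}).

(** Bounds between neighbouring coefficients of [P] are coefficientwise inequalities between
    ['X * P] and multiples of [P]; in this form they survive multiplication by polynomials with
    nonnegative coefficients. *)
Definition coef_le P Q := forall i, P`_i <= Q`_i.

Lemma coef_le_refl P : coef_le P P. Proof. by []. Qed.

Lemma coef_le_trans Q P M : coef_le P Q -> coef_le Q M -> coef_le P M.
Proof. by move=> PQ QM i; exact: le_trans (PQ i) (QM i). Qed.

Lemma coef_leD P Q A B : coef_le P Q -> coef_le A B -> coef_le (P + A) (Q + B).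
Proof. by move=> PQ AB i; rewrite !coefD lerD. Qed.

Lemma coef_leMn P Q n : coef_le P Q -> coef_le (P *+ n) (Q *+ n).
Proof. by move=> PQ i; rewrite !coefMn lerMn2r PQ orbT. Qed.

Lemma coef_leM2l P A B : coef_le 0 P -> coef_le A B -> coef_le (P * A) (P * B).
Proof.
move=> P0 AB i; rewrite !coefM; apply: ler_sum => j _.
by rewrite ler_wpM2l //; have := P0 j; rewrite coef0.
Qed.

Lemma coef_leM2r P A B : coef_le 0 P -> coef_le A B -> coef_le (A * P) (B * P).
Proof. by rewrite ![_ * P]mulrC; exact: coef_leM2l. Qed.

Lemma coef_le0M P Q : coef_le 0 P -> coef_le 0 Q -> coef_le 0 (P * Q).
Proof. by move=> P0 Q0; rewrite -(mulr0 P); exact: coef_leM2l. Qed.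

Lemma coef_le01 : coef_le 0 1.
Proof. by move=> i; rewrite coef0 coef1 ler0n. Qed.

Lemma coef_le0X P n : coef_le 0 P -> coef_le 0 (P ^+ n).
Proof.
by move=> P0; elim: n => [|n IH]; [exact: coef_le01|rewrite exprS; exact: coef_le0M].
Qed.

Lemma coef_le0Xn n : coef_le 0 'X^n.
Proof. by move=> i; rewrite coef0 coefXn ler0n. Qed.

Lemma coef_leM P Q A B : coef_le 0 P -> coef_le 0 B ->
  coef_le P Q -> coef_le A B -> coef_le (P * A) (Q * B).
Proof.
move=> P0 B0 PQ AB; apply: (coef_le_trans (coef_leM2l P0 AB)).
exact: coef_leM2r.
Qed.

Lemma coef_leX P Q n : coef_le 0 P -> coef_le P Q -> coef_le (P ^+ n) (Q ^+ n).
Proof.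
move=> P0 PQ; elim: n => [|n IH]; rewrite ?exprS; first exact: coef_le_refl.
by apply: coef_leM => //; apply: coef_le0X; exact: coef_le_trans PQ.
Qed.

(* Used with [(A, B)] a pair of distinct monomials: passing from [B] to [A]
   shifts the exponents, and [L] is the extreme monomial of [P] in that
   direction. *)
Lemma coef_le_exp A B P L C n : coef_le 0 P -> coef_le 0 B -> coef_le 0 L ->
  coef_le L P -> coef_le (A * P) (B * P *+ C + A * L) ->
  coef_le (A * P ^+ n) (B * P ^+ n *+ (C * n) + A * L ^+ n).
Proof.
move=> P0 B0 L0 LP AP; elim: n => [|n IH].
  by rewrite muln0 mulr0n add0r.
have -> : A * P ^+ n.+1 = A * P * P ^+ n by rewrite exprS mulrA.
apply: (coef_le_trans (coef_leM2r (coef_le0X n P0) AP)).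
rewrite mulrDl.
have -> : A * L * P ^+ n = L * (A * P ^+ n) by ring.
have -> : B * P ^+ n.+1 *+ (C * n.+1) + A * L ^+ n.+1 =
  B * P *+ C * P ^+ n + (P * (B * P ^+ n *+ (C * n)) + L * (A * L ^+ n)).
  by rewrite mulnS mulrnDr !exprS mulrnAl mulrnAr; ring.
apply: coef_leD; first exact: coef_le_refl.
apply: (coef_le_trans (coef_leM2l L0 IH)); rewrite mulrDr.
apply: coef_leD; last exact: coef_le_refl.
apply: coef_leM2r LP; rewrite -(mul0rn _ (C * n)); apply: coef_leMn.
by apply: coef_le0M => //; exact: coef_le0X.
Qed.

(** Two rounds of [coef_le_exp]. The first leaves [A * L ^+ s * Q ^+ t], where every factor [P] is
    at its extreme monomial; writing [A * L ^+ s] as [N * A'] lets the second round shift a factor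
    [Q] instead, and the last hypothesis turns [N * B'] back into [B * P ^+ s]. The rounds cost
    [C * s] and [C * t]. *)
Lemma coef_le_exp2 A B P L C A' B' Q M N s t :
  coef_le 0 P -> coef_le 0 B -> coef_le 0 L -> coef_le L P ->
  coef_le 0 Q -> coef_le 0 B' -> coef_le 0 M -> coef_le M Q -> coef_le 0 N ->
  coef_le (A * P) (B * P *+ C + A * L) ->
  coef_le (A' * Q) (B' * Q + A' * M) ->
  A * L ^+ s = N * A' -> coef_le (N * B') (B * P ^+ s *+ C) ->
  coef_le (A * (P ^+ s * Q ^+ t))
    (B * (P ^+ s * Q ^+ t) *+ (C * (s + t)) + A * L ^+ s * M ^+ t).
Proof.
move=> P0 B0 L0 LP Q0 B'0 M0 MQ N0 AP AQ ALN NB.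
have AQ1 : coef_le (A' * Q) (B' * Q *+ 1 + A' * M) by [].
have Qt0 := coef_le0X t Q0.
rewrite mulrA.
apply: (coef_le_trans (coef_leM2r Qt0 (coef_le_exp s P0 B0 L0 LP AP))).
rewrite mulrDl ALN -!mulrA mulnDr mulrnDr -addrA.
apply: coef_leD; first by rewrite mulrnAl mulrA; exact: coef_le_refl.
apply: (coef_le_trans (coef_leM2l N0 (coef_le_exp t Q0 B'0 M0 MQ AQ1))).
rewrite mulrDr; apply: coef_leD; last exact: coef_le_refl.
rewrite mul1n mulrnAr mulrnA; apply: coef_leMn.
by rewrite !mulrA -mulrnAl; exact: coef_leM2r.
Qed.

End CoefOrder.

Lemma coef_1DX_exp (R : comNzRingType) n i :
  ((1 + 'X) ^+ n : {poly R})`_i = 'C(n, i)%:R.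
Proof.
rewrite exprDn coef_sum; under eq_bigr => j _ do
  rewrite expr1n mul1r coefMn coefXn.
have [ig|gi] := ltnP i n.+1; last first.
  rewrite bin_small // big1 // => j _.
  by rewrite [i == j]gtn_eqF ?mul0rn // (leq_trans (ltn_ord j)).
rewrite (bigD1 (Ordinal ig)) //= eqxx big1 ?addr0 // => j.
by rewrite -val_eqE /= eq_sym => /negPf ->; rewrite mul0rn.
Qed.

Section CutCoef.
Variables (R : numDomainType) (g : nat).
Local Notation p := (cut_poly R g).
Local Notation q := (uncut_poly R g).

Lemma coef_cut_poly i : (0 < g)%N -> 
  p`_i = if (0 < i < g)%N then 'C(g, i)%:R else 0.
Proof.
move=> g_gt0; rewrite /cut_poly /uncut_poly coefB coefD coef1 coefXn.
rewrite coef_1DX_exp.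
case: i => [|i] /=; first by rewrite bin0 (ltn_eqF g_gt0) addr0 subrr.
rewrite add0r; have [ig|gi|->] := ltngtP i.+1 g; rewrite ?subr0 //.
  by rewrite bin_small.
by rewrite binn subrr.
Qed.

Lemma coef_le0_cut : (0 < g)%N -> coef_le 0 p.
Proof. by move=> g_gt0 i; rewrite coef0 coef_cut_poly //; case: ifP. Qed.

Lemma coef_le0_uncut : coef_le 0 q.
Proof. by move=> i; rewrite coef0 coefD coef1 coefXn addr_ge0 ?ler0n. Qed.

Lemma coef_le_Xn_cut i : (0 < i < g)%N -> coef_le ('X^i *+ 'C(g, i)) p.
Proof.
move=> ig j; rewrite coefMn coefXn coef_cut_poly; last by case/andP: ig; case: g.
case: eqP => [->|_]; first by rewrite ig.
by rewrite mul0rn; case: ifP.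
Qed.

Lemma coef_le_X1_cut i : (0 < i < g)%N -> coef_le 'X^i p.
Proof.
move=> ig; apply: coef_le_trans (coef_le_Xn_cut ig).
rewrite -[X in coef_le X _]mulr1n => j; rewrite !coefMn.
apply: ler_wpMn2l; first by rewrite coefXn.
by rewrite bin_gt0; case/andP: ig => _ /ltnW.
Qed.

Lemma bin_le_exp n k : ('C(n, k) <= 2 ^ n)%N.
Proof.
have [kn|nk] := leqP k n; last by rewrite bin_small.
rewrite -[2%N]/(1 + 1)%N expnDn (bigD1 (Ordinal (kn : (k < n.+1)%N))) //=.
by rewrite !exp1n !muln1 leq_addr.
Qed.

(** The factor [2 ^ g] bounds the ratio of two nonzero coefficients of [p]; [g ^ 2] makes up for the
    two factors of [p ^+ s] from which [exp_cut_ge] takes only a coefficient 1 instead of [g]. *)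
Definition step_bound := (2 ^ g * g ^ 2)%N.

Lemma bin_step i j : (0 < g)%N -> (j <= g)%N ->
  ('C(g, i) <= 'C(g, j) * step_bound)%N.
Proof.
move=> g_gt0 jg; apply: leq_trans (bin_le_exp g i) _.
by rewrite mulnCA leq_pmulr // muln_gt0 bin_gt0 jg expn_gt0 g_gt0.
Qed.

Lemma cut_step_up : (1 < g)%N ->
  coef_le ('X * p) (1 * p *+ step_bound + 'X * ('X^(g.-1) *+ 'C(g, g.-1))).
Proof.
move=> g_gt1; have g_gt0 := ltnW g_gt1.
rewrite mul1r mulrnAr -exprS prednK // => i.
rewrite coefXM [in X in _ <= X]coefD !coefMn coefXn !coef_cut_poly //.
case: i => [|i] /=; first by rewrite mul0rn add0r mulrn_wge0 // ler0n.
have [ig|ig] := eqVneq i.+1 g.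
  have -> : g.-1 = i by lia.
  rewrite ig ltnn mul0rn add0r.
  by case: ifP => // _; rewrite mulrn_wge0 // ler0n.
rewrite mul0rn addr0; have [gi|gi] := ltnP i.+1 g;
  last by rewrite ifF ?mul0rn //; apply/negbTE; lia.
case: ifP => // _; last by rewrite mulrn_wge0 ?ler0n.
by rewrite -mulrnA ler_nat bin_step // ltnW.
Qed.

Lemma cut_step_down : (1 < g)%N ->
  coef_le (1 * p) ('X * p *+ step_bound + 1 * ('X *+ 'C(g, 1))).
Proof.
move=> g_gt1; have g_gt0 := ltnW g_gt1.
rewrite !mul1r => i.
rewrite [in X in _ <= X]coefD !coefMn coefXM coefX !coef_cut_poly //.
case: i => [|[|i]] /=; rewrite ?mul0rn ?addr0 ?ltnn //=.
  by rewrite g_gt1 add0r.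
case: ifP => ig; last by rewrite mulrn_wge0 //; case: ifP.
by rewrite ltnW // -mulrnA ler_nat bin_step // ltnW // ltnW.
Qed.

Section Step.
Variables (s t : nat).
Hypotheses (g_gt2 : (2 < g)%N) (s_gt1 : (1 < s)%N).
Local Notation F := (p ^+ s * q ^+ t).

Let g_gt0 : (0 < g)%N := ltnW (ltnW g_gt2).
Let p0 := coef_le0_cut g_gt0.

(** Take ['X^i] from one factor, ['X^j] from another and ['X^k *+ g] from the remaining [s - 2];
    here [k] will be 1 or [g - 1]. *)
Lemma exp_cut_ge i j k : (0 < i < g)%N -> (0 < j < g)%N -> (0 < k < g)%N ->
  'C(g, k) = g ->
  coef_le ('X^(k * (s - 2) + (i + j)) *+ g ^ (s - 2)) (p ^+ s).
Proof.
move=> ig jg kg Cg; have -> : p ^+ s = p ^+ (s - 2) * (p * p).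
  by rewrite -expr2 -exprD subnK.
have -> : 'X^(k * (s - 2) + (i + j)) *+ g ^ (s - 2) =
    ('X^k *+ g) ^+ (s - 2) * ('X^i * 'X^j) :> {poly R}.
  by rewrite exprMn_n mulrnAl -exprM -!exprD.
apply: coef_leM.
- by apply: coef_le0X => l; rewrite coef0 coefMn mulrn_wge0 // coefXn ler0n.
- by apply: coef_le0M.
- apply: coef_leX; last by rewrite -[X in _ *+ X]Cg; exact: coef_le_Xn_cut.
  by move=> l; rewrite coef0 coefMn mulrn_wge0 // coefXn ler0n.
by apply: (coef_leM (coef_le0Xn _ _) p0); exact: coef_le_X1_cut.
Qed.

Lemma exp_cut_ge2 i j k : (0 < i < g)%N -> (0 < j < g)%N -> (0 < k < g)%N ->
  'C(g, k) = g ->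
  coef_le ('X^(k * (s - 2) + (i + j)) *+ g ^ s) (p ^+ s *+ step_bound).
Proof.
move=> ig jg kg Cg; have -> : (g ^ s = g ^ (s - 2) * g ^ 2)%N.
  by rewrite -expnD subnK.
apply: (@coef_le_trans _ (p ^+ s *+ g ^ 2)).
  by rewrite mulrnA; apply: coef_leMn; exact: exp_cut_ge.
move=> l; rewrite !coefMn; apply: ler_wpMn2l.
  by have := coef_le0X s p0 l; rewrite coef0.
by rewrite leq_pmull // expn_gt0.
Qed.

(** To raise the total exponent by one, raise a factor [p] that is below its top exponent [g - 1].
    If there is none, raise a factor [q] from 0 to [g] and lower two factors [p] by [g - 1]
    altogether. Only the top monomial of [F] escapes both moves. *)
Lemma coef_step_up i : (i < g * (s + t) - s)%N ->
  F`_i <= F`_i.+1 *+ (step_bound * (s + t)).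
Proof.
move=> ilt; pose L : {poly R} := 'X^(g.-1) *+ g.
have bg : 'C(g, g.-1) = g by rewrite -subn1 bin_sub ?bin1.
have up : coef_le ('X * F) (1 * F *+ (step_bound * (s + t)) + 'X * L ^+ s *
  'X^g ^+ t).
  (* The last argument is what remains of ['X * L ^+ s] once ['X^g] is split off. Its exponent is
     reached by lowering one factor [p] to 1 and another to [g - 2], which needs [2 < g] and
     [1 < s]. *)
  apply: (@coef_le_exp2 _ 'X 1 p L step_bound 'X^g 1 q 'X^g
    ('X^(g.-1 * s.-1) *+ g ^ s)) => //.
  - exact: coef_le01.
  - by move=> j; rewrite coef0 coefMn coefXn mulrn_wge0.
  - by rewrite /L -[X in _ *+ X]bg; apply: coef_le_Xn_cut; lia.
  - exact: coef_le0_uncut.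
  - exact: coef_le01.
  - exact: coef_le0Xn.
  - by move=> j; rewrite coefD coef1 lerDr ler0n.
  - by move=> j; rewrite coef0 coefMn coefXn mulrn_wge0.
  - by have := cut_step_up (ltnW g_gt2); rewrite bg.
  - by rewrite mul1r /uncut_poly mulrDr mulr1 => j;
    rewrite !coefD lerD2r lerDr coef1.
  - rewrite /L exprMn_n mulrnAr mulrnAl -exprM -exprS -exprD.
    by congr ('X^_ *+ _); nia.
  rewrite mulr1 mul1r.
  have -> : (g.-1 * s.-1 = g.-1 * (s - 2) + (1 + (g - 2)))%N by nia.
  by apply: exp_cut_ge2 => //; lia.
have := up i.+1; rewrite mul1r coefXM /= coefD coefMn => /le_trans; apply.
(* The leftover monomial has degree [g * (s + t) - s + 1], beyond [i.+1]. *)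
rewrite gerDl /L exprMn_n mulrnAr mulrnAl coefMn -!exprM -exprS -exprD coefXn.
by rewrite (_ : _ == _ = false) ?mul0rn //; apply/negbTE; nia.
Qed.

(** The mirror image: lower a factor [p] that is above exponent 1; if there is none, lower a factor
    [q] from [g] to 0 and raise two factors [p] from 1 to 2 and to [g - 1]. *)
Lemma coef_step_down i : (s <= i)%N ->
  F`_i.+1 <= F`_i *+ (step_bound * (s + t)).
Proof.
move=> si; pose L : {poly R} := 'X *+ g.
have dn : coef_le (1 * F) ('X * F *+ (step_bound * (s + t)) + 1 * L ^+ s * 1 ^+ t).
  apply: (@coef_le_exp2 _ 1 'X p L step_bound 1 'X^g q 1 ('X^s *+ g ^ s)) => //.
  - exact: (coef_le0Xn R 1).
  - by move=> j; rewrite coef0 coefMn coefX mulrn_wge0.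
  - by rewrite /L -[X in _ *+ X]bin1; apply: (@coef_le_Xn_cut 1); lia.
  - exact: coef_le0_uncut.
  - exact: coef_le0Xn.
  - exact: coef_le01.
  - by move=> j; rewrite coefD coefXn lerDl ler0n.
  - by move=> j; rewrite coef0 coefMn coefXn mulrn_wge0.
  - by have := cut_step_down (ltnW g_gt2); rewrite bin1.
  - have -> : 'X^g * q + 1 * 1 = q + 'X^(g + g).
      by rewrite /uncut_poly exprD; ring.
    by move=> j; rewrite mul1r [in X in _ <= X]coefD lerDl coefXn.
  - by rewrite /L exprMn_n mul1r mulr1.
  rewrite mulrnAl -exprD (_ : (s + g = (1 * (s - 2) + (2 + g.-1)).+1)%N);
    last by lia.
  rewrite exprS -!mulrnAr; apply: coef_leM2l; first exact: (coef_le0Xn R 1).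
  by apply: exp_cut_ge2; rewrite ?bin1 //; lia.
have := dn i.+1; rewrite mul1r [in X in _ <= X]coefD coefMn coefXM /= =>
  /le_trans; apply.
rewrite gerDl expr1n mulr1 mul1r /L exprMn_n coefMn coefXn.
by rewrite (_ : _ == _ = false) ?mul0rn //; apply/negbTE; lia.
Qed.

End Step.

(** Pick ['X^i *+ g] in each factor [p] and ['X^j] in each factor [q]. The pairs [(1, 0)] and
    [(g - 1, g)] give the least and the greatest exponent of [F]. *)
Lemma coef_cut_monomial i j s t : (0 < i < g)%N -> 'C(g, i) = g -> j \in [:: 0;
  g]%N ->
  (g ^ s)%:R <= (p ^+ s * q ^+ t)`_(i * s + j * t).
Proof.
move=> ig Cg jg.
have Xi0 : coef_le 0 ('X^i *+ g : {poly R}).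
  by move=> l; rewrite coef0 coefMn coefXn mulrn_wge0 // ler0n.
have le : coef_le (('X^i *+ g) ^+ s * ('X^j) ^+ t) (p ^+ s * q ^+ t).
  apply: coef_leM; [exact: coef_le0X| |apply: coef_leX|apply: coef_leX] => //.
  - by apply: coef_le0X; exact: coef_le0_uncut.
  - by rewrite -{1}Cg; exact: coef_le_Xn_cut.
  - exact: coef_le0Xn.
  - move=> l; rewrite [in X in _ <= X]coefD coef1 !coefXn.
    by move: jg; rewrite !inE => /orP[] /eqP ->; rewrite ?lerDl ?lerDr ?ler0n.
apply: le_trans (le _); rewrite exprMn_n -!exprM mulrnAl -exprD coefMn coefXn eqxx.
by [].
Qed.

End CutCoef.

(** With truncated subtraction, [(i - k) + (k - i)] is the distance between [i] and [k]; the bounds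
    for neighbours are chained along it. *)
Lemma adjacent_ratio (R : numDomainType) (f : nat -> R) (M : R) (a b : nat) :
    0 <= M ->
    (forall i, (a <= i < b)%N -> f i <= M * f i.+1) ->
    (forall i, (a <= i < b)%N -> f i.+1 <= M * f i) ->
  forall i k, (a <= i <= b)%N -> (a <= k <= b)%N ->
    f i <= M ^+ ((i - k) + (k - i)) * f k.
Proof.
move=> M0 up dn.
have upn d i : (a <= i)%N -> (i + d <= b)%N -> f i <= M ^+ d * f (i + d)%N.
  elim: d i => [|d IH] i ai idb; first by rewrite addn0 mul1r.
  apply: (le_trans (up i _)); first by lia.
  rewrite exprS -mulrA -addSnnS ler_wpM2l // IH //; lia.
have dnn d i : (a <= i)%N -> (i + d <= b)%N -> f (i + d)%N <= M ^+ d * f i.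
  elim: d i => [|d IH] i ai idb; first by rewrite addn0 mul1r.
  rewrite -addSnnS; apply: (le_trans (IH i.+1 _ _)); [lia|lia|].
  by rewrite exprSr -mulrA ler_wpM2l ?exprn_ge0 // dn //; lia.
move=> i k /andP[ai ib] /andP[ak kb]; have [ik|ki] := leqP i k.
  have -> : (i - k + (k - i) = k - i)%N by lia.
  by rewrite -{2}(subnKC ik) upn //; lia.
have -> : (i - k + (k - i) = i - k)%N by lia.
by rewrite -{1}(subnKC (ltnW ki)) dnn //; lia.
Qed.

Section CutCoef.
Variables (R : numDomainType) (g : nat).
Local Notation p := (cut_poly R g).
Local Notation q := (uncut_poly R g).

Lemma cut_polyX : (0 < g)%N -> p = 'X * \poly_(j < g) p`_j.+1.
Proof.
move=> g_gt0; apply/polyP => j; rewrite coefXM coef_poly coef_cut_poly //.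
case: j => //= j; rewrite !coef_cut_poly //.
by case: (ltnP j g) => // jg; rewrite ifF //; lia.
Qed.

Lemma coef_uncut_exp t i : (0 < g)%N ->
  (q ^+ t)`_i = if (g %| i)%N then 'C(t, i %/ g)%:R else 0.
Proof.
move=> g_gt0; have -> : q ^+ t = (1 + 'X) ^+ t \Po 'X^g.
  by rewrite rmorphXn rmorphD /= comp_polyX comp_polyC.
by rewrite coef_comp_poly_Xn // coef_1DX_exp.
Qed.

(** In these two cases [F] is a monomial times a power of [q], so its nonzero coefficients are [g]
    apart and neighbours cannot be compared. *)
Lemma cut_exp_lattice s : (g == 2) || (s == 0%N) -> p ^+ s = 'X^s *+ g ^ s.
Proof.
case/orP => /eqP ->; last by rewrite !expr0 expn0 mulr1n.
have -> : cut_poly R 2 = 'X *+ 2 by rewrite /cut_poly /uncut_poly; ring.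
by rewrite exprMn_n.
Qed.

Section Exp.
Variables (s t : nat).
Local Notation F := (p ^+ s * q ^+ t).

Lemma coef_lattice i : (0 < g)%N -> (g == 2) || (s == 0%N) ->
  F`_i = if (s <= i)%N && (g %| i - s)%N
         then 'C(t, (i - s) %/ g)%:R *+ g ^ s else 0.
Proof.
move=> g_gt0 /cut_exp_lattice ->; rewrite mulrnAl coefMn coefXnM.
rewrite coef_uncut_exp // ltnNge.
by case: leqP => //= _; rewrite ?mul0rn //; case: ifP => _; rewrite ?mul0rn.
Qed.

(** The exponents of [p] lie between 1 and [g - 1], those of [q] between 0 and [g]. *)
Lemma coef_support i : (0 < g)%N -> F`_i != 0 -> (s <= i <= g * (s + t) - s)%N.
Proof.
move=> g_gt0; apply: contraR; rewrite negb_and -!ltnNge => /orP[i_s|i_big].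
  by rewrite (cut_polyX g_gt0) exprMn -mulrA coefXnM i_s.
have sp : (size p <= g)%N.
  apply/leq_sizeP => j gj; rewrite coef_cut_poly // ifF //; apply/negbTE; lia.
have sq : (size q <= g.+1)%N.
  apply/leq_sizeP => j gj; rewrite coefD coef1 coefXn.
  by rewrite (gtn_eqF gj) (gtn_eqF (leq_ltn_trans _ gj)) ?addr0.
apply/eqP/nth_default; apply: leq_trans (size_polyMleq _ _) _.
have := size_poly_exp_leq p s; have := size_poly_exp_leq q t.
nia.
Qed.

Lemma bin_ratio n i k : (i <= n)%N -> (k <= n)%N ->
  'C(n, i)%:R <= n%:R ^+ ((i - k) + (k - i)) * 'C(n, k)%:R :> R.
Proof.
move=> i_n k_n.
apply: (@adjacent_ratio R (fun j => 'C(n, j)%:R) n%:R 0 n) => // j /andP[_ jn];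
  rewrite -natrM ler_nat.
  apply: (@leq_trans (j.+1 * 'C(n, j.+1))); last by rewrite leq_mul2r jn orbT.
  by rewrite mul_bin_left leq_pmull // subn_gt0.
apply: (@leq_trans (j.+1 * 'C(n, j.+1))); first by rewrite leq_pmull.
by rewrite mul_bin_left leq_mul2r leq_subr orbT.
Qed.

(* For [s = 1] and [2 < g], [F] has zero coefficients at multiples of [g] strictly
   inside its range of exponents, and the ratio of neighbours is not bounded. *)
Definition regular_exponents := [|| g == 2, s == 0%N | (2 < g) && (1 < s)]%N.

(** Outside the lattice case neighbours are compared one by one. In the lattice case the nonzero
    coefficients are binomials with a common factor, and their indices are no further apart than [i]
    and [k]. *)
Lemma coef_ratio i k : (0 < g)%N -> (0 < s + t)%N -> regular_exponents ->
  F`_i != 0 -> F`_k != 0 ->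
  F`_i <= (step_bound g * (s + t))%:R ^+ ((i - k) + (k - i)) * F`_k.
Proof.
move=> g_gt0 st_gt0 reg Fi Fk.
have [lat|nlat] := boolP ((g == 2) || (s == 0%N)); last first.
  have /andP[g2 s1] : (2 < g)%N && (1 < s)%N.
    by move: reg; rewrite /regular_exponents orbA (negPf nlat).
  apply: (@adjacent_ratio _ _ _ s (g * (s + t) - s)); rewrite ?ler0n //.
  - by move=> j /andP[_ js]; rewrite mulr_natl coef_step_up.
  - by move=> j /andP[sj _]; rewrite mulr_natl coef_step_down.
  - exact: coef_support.
  - exact: coef_support.
move: Fi Fk; rewrite !coef_lattice //.
case: ifP => [/andP[si gi]|]; rewrite ?eqxx // => Fi.
case: ifP => [/andP[sk gk]|]; rewrite ?eqxx // => Fk.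
have le_t j : 'C(t, j)%:R *+ g ^ s != 0 :> R -> (j <= t)%N.
  by apply: contraR; rewrite -ltnNge => tj; rewrite bin_small // mul0rn.
rewrite mulrnAr lerMn2r; apply/orP; right.
apply: (le_trans (bin_ratio (le_t _ Fi) (le_t _ Fk))).
rewrite ler_wpM2r ?ler0n // -!natrX ler_nat.
have B_gt0 : (0 < step_bound g)%N by rewrite muln_gt0 !expn_gt0 g_gt0.
have dist_le (a b : nat) : (a * g - b * g <= (a * g + s) - (b * g + s))%N by lia.
have -> : (i = (i - s) %/ g * g + s)%N by rewrite divnK // subnK.
have -> : (k = (k - s) %/ g * g + s)%N by rewrite divnK // subnK.
rewrite !addnK !mulnK //; move: ((i - s) %/ g)%N ((k - s) %/ g)%N => a b.
apply: (@leq_trans ((step_bound g * (s + t)) ^ (a - b + (b - a)))).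
  by case: (a - b + (b - a))%N => // e; rewrite leq_exp2r //; nia.
by rewrite leq_pexp2l ?muln_gt0 ?B_gt0 //; nia.
Qed.

(** Were the coefficient of degree [k] zero, the chain of neighbour bounds would make that of degree
    [s] nonpositive, whereas it is at least [g ^ s]. *)
Lemma coef_gt0 k : (2 < g)%N -> (1 < s)%N -> (s <= k <= g * (s + t) - s)%N ->
  0 < F`_k.
Proof.
move=> g2 s1 sk; have g_gt0 : (0 < g)%N by lia.
have F_ge0 : coef_le 0 F.
  by apply: coef_le0M; apply: coef_le0X; [exact: coef_le0_cut|
    exact: coef_le0_uncut].
have ss : (s <= s <= g * (s + t) - s)%N by rewrite leqnn; nia.
have Fs : 0 < F`_s.
  have := @coef_cut_monomial R g 1 0 s t; rewrite mul1n mul0n addn0 bin1 inE.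
  by move=> /(_ (ltnW g2) erefl erefl); apply: lt_le_trans;
    rewrite ltr0n expn_gt0 g_gt0.
have M0 : 0 <= (step_bound g * (s + t))%:R :> R by rewrite ler0n.
have := adjacent_ratio M0 _ _ ss sk => /(_ (fun j => F`_j)) Fsk.
rewrite lt_def; have := F_ge0 k; rewrite coef0 => ->; rewrite andbT.
apply: contraTneq Fs => Fk0; rewrite le_gtF //; move: Fsk; rewrite Fk0 mulr0; apply.
  by move=> j /andP[_ js]; rewrite mulr_natl coef_step_up.
by move=> j /andP[sj _]; rewrite mulr_natl coef_step_down.
Qed.

End Exp.
End CutCoef.

(** * Concentration around the saddle point *)

Section Moments.
Variable R : realFieldType.
Implicit Types (P Q : {poly R}) (u a b : R).

(** The operator X d/dX. Its iterates, evaluated at [u], are the unnormalised moments of the random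
    exponent. *)
Definition euler_op P : {poly R} := \poly_(i < size P) (P`_i * i%:R).

Lemma coef_euler_op P i : (euler_op P)`_i = P`_i * i%:R.
Proof. by rewrite coef_poly; case: ltnP => // /(nth_default 0) ->;
  rewrite mul0r. Qed.

Lemma euler_opE P : euler_op P = 'X * P^`().
Proof.
apply/polyP => i; rewrite coef_euler_op coefXM coef_deriv.
by case: i => [|i]; rewrite ?mulr0 // mulr_natr.
Qed.

Lemma euler_opM P Q : euler_op (P * Q) = euler_op P * Q + P * euler_op Q.
Proof. by rewrite !euler_opE derivM; ring. Qed.

Lemma euler_opD P Q : euler_op (P + Q) = euler_op P + euler_op Q.
Proof. by rewrite !euler_opE derivD; ring. Qed.

Lemma euler_opC a : euler_op a%:P = 0.
Proof. by rewrite euler_opE derivC mulr0. Qed.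

(* For the random exponent [i] of weight [P`_i u^i / P.[u]]: its mean is [a]
   and its variance is [b]. *)
Definition moments P u a b :=
  (euler_op P).[u] = a * P.[u] /\
  (euler_op (euler_op P)).[u] - 2 * a * (euler_op P).[u] + a ^+ 2 * P.[u] =
  b * P.[u].

Lemma moments1 u : moments 1 u 0 0.
Proof. by rewrite /moments !euler_opC horner0; split; ring. Qed.

(** Covers [p] for [g = 1], where no normalisation is possible. *)
Lemma moments0 u a b : moments 0 u a b.
Proof. by rewrite /moments !euler_opC horner0; split; ring. Qed.

(** The random exponent of a product is a sum of independent ones, so means and variances add. *)
Lemma momentsM P Q u a b c d : moments P u a b -> moments Q u c d ->
  moments (P * Q) u (a + c) (b + d).
Proof.
move=> [P1 P2] [Q1 Q2]; split; rewrite !(euler_opM, euler_opD, hornerD, hornerM).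
  by rewrite P1 Q1; ring.
have -> : (b + d) * (P.[u] * Q.[u]) = (b * P.[u]) * Q.[u] + P.[u] * (d * Q.[u]).
  by ring.
by rewrite -P2 -Q2 P1 Q1; ring.
Qed.

Lemma momentsX P u a b n : moments P u a b ->
  moments (P ^+ n) u (a *+ n) (b *+ n).
Proof.
move=> mP; elim: n => [|n IH]; first by rewrite expr0 !mulr0n; exact: moments1.
by rewrite exprS !mulrS; exact: momentsM.
Qed.

Lemma moments_ex P u : P.[u] != 0 ->
  exists b, moments P u ((euler_op P).[u] / P.[u]) b.
Proof.
move=> Pu; set a := _ / _; eexists (_ / P.[u]); split; first by rewrite mulfVK.
by rewrite mulfVK.
Qed.

Lemma euler_horner P u N : (size P <= N)%N ->
  (euler_op P).[u] = \sum_(i < N) P`_i * u ^+ i * i%:R.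
Proof.
move=> sP; rewrite (@horner_coef_wide _ N).
  by apply: eq_bigr => i _; rewrite coef_euler_op mulrAC.
by apply/leq_sizeP => j Nj;
  rewrite coef_euler_op nth_default ?mul0r // (leq_trans sP).
Qed.

(** The terms at distance more than [D] from [k] carry at most the fraction [b / D^2 <= 1/2] of
    [P.[u]]. *)
Lemma chebyshev P u b k D N : (forall i, 0 <= P`_i) -> 0 <= u ->
  moments P u k%:R b -> (size P <= N)%N -> (0 < D)%N -> b * 2 <= D%:R ^+ 2 ->
  P.[u] <= 2 * \sum_(i < N | ((i - k) + (k - i) <= D)%N) P`_i * u ^+ i.
Proof.
move=> P0 u0 [_ Pb] sP D0 bD.
pose near (i : 'I_N) := ((i - k) + (k - i) <= D)%N.
set S := \sum_(i < N | _) _; pose S' := \sum_(i < N | ~~ near i) P`_i * u ^+ i.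
have sE : (size (euler_op P) <= N)%N.
  by apply/leq_sizeP => j Nj;
    rewrite coef_euler_op nth_default ?mul0r // (leq_trans sP).
have Pu : P.[u] = \sum_(i < N) P`_i * u ^+ i by exact: horner_coef_wide.
have {}Pb : b * P.[u] = \sum_(i < N) P`_i * u ^+ i * (i%:R - k%:R) ^+ 2.
  rewrite -Pb (euler_horner u sE) (euler_horner u sP) [in _ ^+ 2 * _]Pu.
  rewrite !mulr_sumr -sumrB -big_split /=.
  by apply: eq_bigr => i _; rewrite coef_euler_op; ring.
have PS : P.[u] = S + S' by rewrite Pu (bigID near).
have w0 i : 0 <= P`_i * u ^+ i by rewrite mulr_ge0 ?exprn_ge0.
have DS : D%:R ^+ 2 * S' <= b * P.[u].
  rewrite Pb (bigID near) /= -[X in X <= _]add0r lerD //.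
    by apply: sumr_ge0 => i _; rewrite mulr_ge0 // sqr_ge0.
  rewrite mulr_sumr; apply: ler_sum => i; rewrite /near -ltnNge => far.
  rewrite [X in X <= _]mulrC ler_wpM2l // -[X in _ <= X]real_normK ?num_real //.
  rewrite lerXn2r ?nnegrE ?ler0n // distrC.
  have [ik|ki] := leqP i k.
    by rewrite ger0_norm ?subr_ge0 ?ler_nat // -natrB // ler_nat; lia.
  by rewrite distrC ger0_norm ?subr_ge0 ?ler_nat -?natrB ?ler_nat; lia.
have Pu0 : 0 <= P.[u] by rewrite Pu; apply: sumr_ge0.
have D2 : 0 < D%:R ^+ 2 :> R by rewrite exprn_gt0 // ltr0n.
have : D%:R ^+ 2 * (S' * 2) <= D%:R ^+ 2 * P.[u].
  apply: (@le_trans _ _ (b * 2 * P.[u])); last by rewrite ler_wpM2r.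
  by rewrite mulrA [b * 2 * _]mulrAC ler_wpM2r.
by rewrite ler_pM2l // PS => SP; lra.
Qed.

(** Inside the Chebyshev window each of the at most [N] terms is bounded by the term of degree [k],
    with a loss per step of [M] for the coefficient and [U] for the power of [u]. *)
Lemma coef_lower P u b k D N M U : (forall i, 0 <= P`_i) -> 0 < u ->
  moments P u k%:R b -> (size P <= N)%N -> (0 < D)%N -> b * 2 <= D%:R ^+ 2 ->
  1 <= M -> u <= U -> u^-1 <= U ->
  (forall i, P`_i != 0 -> P`_i <= M ^+ ((i - k) + (k - i)) * P`_k) ->
  P.[u] <= 2 * N%:R * (M * U) ^+ D * (P`_k * u ^+ k).
Proof.
move=> P0 u0 mP sP D0 bD M1 uU vU Pk.
apply: (le_trans (chebyshev P0 (ltW u0) mP sP D0 bD)).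
rewrite -!mulrA ler_pM2l // !mulrA -[N in N%:R]card_ord -sumr_const !mulr_suml.
have U1 : 1 <= U.
  have [u1|/ltW u1] := lerP 1 u; first exact: le_trans uU.
  by apply: le_trans vU; rewrite invf_ge1.
have c0 : 0 <= (M * U) ^+ D * P`_k * u ^+ k.
  rewrite !mulr_ge0 ?exprn_ge0 ?mulr_ge0 // ?(ltW u0) //.
  - exact: le_trans M1.
  - exact: le_trans U1.
rewrite big_mkcond; apply: ler_sum => i _; rewrite mul1r.
case: ifP => // iD; have [->|/Pk Pik] := eqVneq P`_i 0; first by rewrite mul0r.
set d := ((i - k) + (k - i))%N in iD Pik.
have MU1 : 1 <= M * U by rewrite -[1]mulr1 ler_pM.
have ud : u ^+ i <= U ^+ d * u ^+ k.
  have [ik|ki] := leqP i k.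
    have -> : d = (k - i)%N by rewrite /d; lia.
    rewrite -[X in _ * _ ^+ X](subnK ik) exprD mulrA ler_peMl ?exprn_ge0 ?(ltW
      u0) //.
    by rewrite -exprMn exprn_ege1 // -[X in X <= _](mulVf (lt0r_neq0 u0)) ler_pM2r.
  have -> : d = (i - k)%N by rewrite /d; lia.
  rewrite -{1}(subnK (ltnW ki)) exprD ler_wpM2r ?exprn_ge0 ?(ltW u0) //.
  by rewrite lerXn2r ?nnegrE ?(ltW u0) // (le_trans _ U1).
apply: (@le_trans _ _ ((M * U) ^+ d * P`_k * u ^+ k)).
  have -> : (M * U) ^+ d * P`_k * u ^+ k = (M ^+ d * P`_k) * (U ^+ d * u ^+ k).
    by rewrite exprMn; ring.
  by apply: ler_pM => //; rewrite exprn_ge0 // ltW.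
by rewrite -!mulrA ler_wpM2r ?mulr_ge0 ?exprn_ge0 ?(ltW u0) // ler_weXn2l.
Qed.

End Moments.

From mathcomp Require Import all_classical all_reals all_analysis.
Import numFieldNormedType.Exports.
Local Open Scope classical_set_scope.
Local Open Scope ring_scope.

(** The coefficient of degree [delta * m1] in [sum_cut_blocks] counts the socket sets of that size
    with [s] cut nets. *)
Lemma cutsize_distributionE (R : realType) (gamma delta n m s m1 : nat) :
  (0 < gamma)%N -> (gamma * n = delta * m)%N -> (0 < m1 < m)%N ->
  cutsize_distribution R gamma delta n m s m1 =
  'C(m, m1)%:R * 'C(n, s)%:R
  * (cut_poly R gamma ^+ s * uncut_poly R gamma ^+ (n - s))`_(delta * m1)
  / 'C(gamma * n, delta * m1)%:R.
Proof.
move=> g_gt0 gn_dm m1m; have hd : (m * delta = gamma * n)%N by rewrite mulnC.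
have hg := mulnC n gamma.
have C0 : ('C(gamma * n, m1 * delta)%:R : R) != 0.
  by rewrite pnatr_eq0 -lt0n bin_gt0 -hd leq_mul2r ltnW ?orbT //; case/andP: m1m.
have F0 : ((gamma * n)`!%:R : R) != 0 by rewrite pnatr_eq0 -lt0n fact_gt0.
rewrite /cutsize_distribution [(delta * m1)%N]mulnC.
apply/(mulIf F0); rewrite mulfVK //; apply/(mulIf C0).
rewrite -[LHS]natrM (sum_nb_bipartitions hg hd) // !natrM [RHS]mulrAC mulfVK //.
congr (_ * _); rewrite -mulrA; congr (_ * _).
have := congr1 (fun P : {poly R} => P`_(m1 * delta)) (sum_cut_blocks R hg s g_gt0).
rewrite coefMn mulr_natl => <-; rewrite coef_sum -sum1_card natr_sum.
rewrite big_mkcond [RHS]big_mkcond /=; apply: eq_bigr => T _.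
rewrite inE; case: (_ == s) => //=; rewrite coefXn eq_sym.
by case: (_ == _).
Qed.

(** * The objective function *)

Lemma coef_le_horner (R : numDomainType) (P Q : {poly R}) (u : R) :
  coef_le P Q -> 0 <= u -> P.[u] <= Q.[u].
Proof.
move=> PQ u0; rewrite -subr_ge0 -hornerN -hornerD horner_coef.
by apply: sumr_ge0 => i _; rewrite mulr_ge0 ?exprn_ge0 // coefB subr_ge0.
Qed.

Section Objective.
Variables (R : realType) (g : nat).
Hypothesis g_gt0 : (0 < g)%N.
Implicit Types (u v sigma mu : R).
Local Notation p := (cut_poly R g).
Local Notation q := (uncut_poly R g).

Definition ln_objective sigma mu u : R :=
  sigma * ln p.[u] + (1 - sigma) * ln q.[u] - mu * g%:R * ln u.

Lemma pfunE : pfun g = horner p.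
Proof.
by apply/funext => u; rewrite /pfun /cut_poly /uncut_poly !hornerE; ring.
Qed.

Lemma qfunE : qfun g = horner q.
Proof. by apply/funext => u; rewrite /qfun /uncut_poly !hornerE. Qed.

Lemma objectiveE sigma mu u :
  objective g sigma mu u = ln_objective sigma mu u / ln 2.
Proof. by rewrite /objective /ln_objective pfunE qfunE /log2; ring. Qed.

Lemma Xn_le_cut i u : (0 < i < g)%N -> 0 <= u -> u ^+ i <= p.[u].
Proof.
by move=> ig u0; have := coef_le_horner (coef_le_X1_cut R ig) u0; rewrite hornerXn.
Qed.

Lemma horner_cut_gt0 u : (1 < g)%N -> 0 < u -> 0 < p.[u].
Proof.
move=> g1 u0; apply: lt_le_trans (Xn_le_cut (i := 1) _ (ltW u0)) => //.
Qed.

Lemma cut_poly1 : cut_poly R 1 = 0.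
Proof. by rewrite /cut_poly /uncut_poly; ring. Qed.

Lemma horner_uncutE u : q.[u] = 1 + u ^+ g.
Proof. by rewrite /uncut_poly !hornerE. Qed.

Lemma horner_uncut_gt0 u : 0 <= u -> 0 < q.[u].
Proof. by move=> u0; rewrite horner_uncutE ltr_pwDl // exprn_ge0. Qed.

Lemma ler_ln_pos u v : 0 < u -> u <= v -> ln u <= ln v.
Proof.
by move=> u0 uv; rewrite ler_ln // posrE // (lt_le_trans u0).
Qed.

(* Otherwise [p = 0] and the cutsize distribution vanishes. *)
Definition cut_nontrivial sigma := (1 < g)%N || (sigma == 0).

Section Fixed.
Variables (sigma mu : R).
Hypotheses (hsigma : 0 <= sigma <= 1) (nd : cut_nontrivial sigma).
Local Notation f := (ln_objective sigma mu).

Lemma sigma_ln_cut_ge u i : 0 < u -> (0 < i < g)%N || (sigma == 0) ->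
  sigma * (ln u *+ i) <= sigma * ln p.[u].
Proof.
move=> u0; have /andP[s0 _] := hsigma.
case/orP => [ig|/eqP ->]; last by rewrite !mul0r.
by rewrite ler_wpM2l // -lnXn // ler_ln_pos ?exprn_gt0 // Xn_le_cut // ltW.
Qed.

(** From [p(u) >= u] and [q(u) >= 1]. The bound at infinity comes from [p(u) >= u^(g-1)] and
    [q(u) >= u^g]. Together they make the objective coercive when both inequalities on [sigma] are
    strict. *)
Lemma ln_objective_ge_near0 u : 0 < u -> (sigma - mu * g%:R) * ln u <= f u.
Proof.
move=> u0; have /andP[s0 s1] := hsigma.
have sp : sigma * ln u <= sigma * ln p.[u].
  by rewrite -[ln u]mulr1n; apply: sigma_ln_cut_ge.
have lq : 0 <= (1 - sigma) * ln q.[u].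
  by rewrite mulr_ge0 ?subr_ge0 // ln_ge0 // horner_uncutE lerDl exprn_ge0 // ltW.
by rewrite /ln_objective mulrBl lerD2r -[leLHS]addr0 lerD.
Qed.

Lemma ln_objective_ge_infty u : 0 < u ->
  (g%:R - sigma - mu * g%:R) * ln u <= f u.
Proof.
move=> u0; have /andP[s0 s1] := hsigma.
have sp : sigma * (ln u *+ g.-1) <= sigma * ln p.[u].
  by apply: sigma_ln_cut_ge => //; case/orP: nd => [g1|->]; rewrite ?orbT //; lia.
have lq : (1 - sigma) * (ln u *+ g) <= (1 - sigma) * ln q.[u].
  rewrite ler_wpM2l ?subr_ge0 // -lnXn // ler_ln_pos ?exprn_gt0 //.
  by rewrite horner_uncutE lerDr.
have gE : g%:R = g.-1%:R + 1 :> R by rewrite -[in LHS](prednK g_gt0) natr1.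
have -> : (g%:R - sigma - mu * g%:R) * ln u =
    sigma * (ln u *+ g.-1) + (1 - sigma) * (ln u *+ g) - mu * g%:R * ln u.
  by rewrite -[ln u *+ g.-1]mulr_natr -[ln u *+ g]mulr_natr gE; ring.
by rewrite lerD2r lerD.
Qed.

Lemma is_derive_ln_objective u : 0 < u ->
  is_derive u 1 (f : R -> R) (sigma * (p^`().[u] / p.[u])
    + (1 - sigma) * (q^`().[u] / q.[u]) - mu * g%:R / u).
Proof.
move=> u0.
have dpoly (P : {poly R}) v : is_derive v 1 (horner P) P^`().[v].
  apply: DeriveDef; first exact: derivable_horner.
  by rewrite -derive1E -derivE.
have dln (P : {poly R}) : 0 < P.[u] ->
    is_derive u 1 (fun v => ln P.[v]) (P^`().[u] / P.[u]).
  move=> Pu; rewrite mulrC.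
  exact: (is_derive1_comp (is_derive1_ln Pu) (dpoly P u)).
have dlnu : is_derive u 1 (@ln R) u^-1 := is_derive1_ln u0.
have dp : is_derive u 1 (fun v => sigma * ln p.[v]) (sigma * (p^`().[u] / p.[u])).
  (* For [sigma = 0] the polynomial [p] may be zero, but then the term is constant. *)
  case/orP: nd => [g1|/eqP ->].
    have := dln p (horner_cut_gt0 g1 u0) => ?.
    exact: is_deriveZ.
  rewrite mul0r; under eq_fun do rewrite mul0r.
  exact: is_derive_cst.
have dq := dln q (horner_uncut_gt0 (ltW u0)).
have dq' : is_derive u 1 (fun v => (1 - sigma) * ln q.[v])
   ((1 - sigma) * (q^`().[u] / q.[u])) by exact: is_deriveZ.
have du : is_derive u 1 (fun v => mu * g%:R * ln v) (mu * g%:R * u^-1).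
  exact: is_deriveZ.
exact: is_deriveB (is_deriveD dp dq') du.
Qed.

Lemma stationary_at_min u : 0 < u -> (forall v, 0 < v -> f u <= f v) ->
  sigma * (p^`().[u] / p.[u]) + (1 - sigma) * (q^`().[u] / q.[u])
  - mu * g%:R / u = 0.
Proof.
move=> u0 umin; have du := is_derive_ln_objective u0.
have : is_derive u 1 (f : R -> R) 0.
  apply: (@derive1_at_min _ f 0 (u + 1)).
  - by lra.
  - by move=> t; rewrite in_itv /= => /andP[t0 _];
      have [] := is_derive_ln_objective t0.
  - by rewrite in_itv /= u0 ltrDl ltr01.
  - by move=> t; rewrite in_itv /= => /andP[t0 _]; exact: umin.
by move=> d0; rewrite -(@derive_val _ _ _ _ _ _ _ du) (@derive_val _ _ _ _ _ _ _ d0).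
Qed.

Lemma ln_objective_min : sigma < mu * g%:R -> sigma < g%:R - mu * g%:R ->
  exists2 u, 0 < u & forall v, 0 < v -> f u <= f v.
Proof.
move=> lt0 ltoo.
have c0 : 0 < mu * g%:R - sigma by rewrite subr_gt0.
have coo : 0 < g%:R - sigma - mu * g%:R by lra.
have f1 : 0 <= f 1 by have := ln_objective_ge_near0 ltr01; rewrite ln1 mulr0.
(* At [a] and [b] the two coercivity bounds equal [f 1]; as [f 1 >= 0], these points enclose 1, and
   a minimum over [[a, b]] is global. *)
pose a := expR (- (f 1 / (mu * g%:R - sigma))).
pose b := expR (f 1 / (g%:R - sigma - mu * g%:R)).
have a1 : a <= 1 by rewrite -[leRHS]expR0 ler_expR oppr_le0 divr_ge0 // ltW.
have b1 : 1 <= b by rewrite -[leLHS]expR0 ler_expR divr_ge0 // ltW.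
have cf : {within `[a, b], continuous (f : R -> R)}.
  apply: derivable_within_continuous => t; rewrite in_itv /= => /andP[a_t _].
  by have [] := is_derive_ln_objective (lt_le_trans (expR_gt0 _) a_t).
have [u uab umin] := EVT_min (le_trans a1 b1) cf.
have uf1 : f u <= f 1 by apply: umin; rewrite in_itv /= a1 b1.
exists u => [|v v0].
  by move: uab; rewrite in_itv /= => /andP[au _]; exact: lt_le_trans (expR_gt0 _) au.
have [va|av] := ltP v a.
  apply: le_trans uf1 _; apply: le_trans (ln_objective_ge_near0 v0).
  have lnv : ln v <= - (f 1 / (mu * g%:R - sigma)).
    by rewrite -[leRHS]expRK ler_ln_pos // ltW.
  rewrite -opprB mulNr -mulrN -ler_pdivrMl // mulrC; lra.
have [bv|vb] := ltP b v.
  apply: le_trans uf1 _; apply: le_trans (ln_objective_ge_infty v0).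
  have lnv : f 1 / (g%:R - sigma - mu * g%:R) <= ln v.
    by rewrite -[leLHS]expRK ler_ln_pos ?expR_gt0 // ltW.
  by rewrite -ler_pdivrMl // mulrC.
by apply: umin; rewrite in_itv /= av vb.
Qed.

End Fixed.
End Objective.

Lemma ln2_gt0 (R : realType) : 0 < ln 2 :> R.
Proof. by rewrite ln_gt0 // ltr1n. Qed.

Lemma ge_at_right0 (R : realType) (h : R -> R) (l : R) :
  {for 0, continuous h} -> (forall u, 0 < u -> l <= h u) -> l <= h 0.
Proof.
move=> h0 lh; rewrite leNgt; apply/negP => hl.
have hlt : \forall u \near (0 : R), h u < l.
  exact: (cvgr_lt (h 0) h0 l hl).
near (0 : R)^'+ => u.
have : h u < l by near: u; exact: cvg_within hlt.
by rewrite ltNge lh.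
Unshelve. all: by end_near. Qed.

Section Infimum.
Variables (R : realType) (g : nat).
Hypothesis g_gt0 : (0 < g)%N.
Implicit Types (sigma mu u v x l : R).
Local Notation p := (cut_poly R g).
Local Notation q := (uncut_poly R g).

Definition inf_objective (sigma mu : R) : R :=
  inf [set objective g sigma mu u | u in [set u : R | 0 < u]].

(** A lower bound is what makes [inf] a genuine infimum. The bound near 0 serves for [u <= 1], the
    one at infinity for [u >= 1]. *)
Lemma ln_objective_ge0 sigma mu u : 0 <= sigma <= 1 -> cut_nontrivial g sigma ->
  sigma <= g%:R * mu -> sigma <= g%:R * (1 - mu) -> 0 < u ->
  0 <= ln_objective g sigma mu u.
Proof.
move=> s01 nd s0 s1 u0; have [u1|/ltW u1] := leP u 1.
  apply: le_trans (ln_objective_ge_near0 mu s01 nd u0).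
  by rewrite mulr_le0 ?ln_le0 // subr_le0 mulrC.
apply: le_trans (ln_objective_ge_infty g_gt0 mu s01 nd u0).
by rewrite mulr_ge0 ?ln_ge0 // ; lra.
Qed.

Lemma inf_objective_le sigma mu u : 0 <= sigma <= 1 -> cut_nontrivial g sigma ->
  sigma <= g%:R * mu -> sigma <= g%:R * (1 - mu) -> 0 < u ->
  inf_objective sigma mu * ln 2 <= ln_objective g sigma mu u.
Proof.
move=> s01 nd s0 s1 u0; rewrite -ler_pdivlMr ?ln2_gt0 // -objectiveE.
apply: ge_inf; last by exists u.
exists 0 => _ [v v0 <-]; rewrite objectiveE //.
by rewrite divr_ge0 ?ln_objective_ge0 // ltW // ln2_gt0.
Qed.

Lemma inf_objective_ge sigma mu x :
  (forall u, 0 < u -> x <= ln_objective g sigma mu u) ->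
  x <= inf_objective sigma mu * ln 2.
Proof.
move=> xf; rewrite -ler_pdivrMr ?ln2_gt0 //; apply: lb_le_inf.
  by exists (objective g sigma mu 1), 1 => //=.
move=> _ [v v0 <-]; rewrite objectiveE // ler_pM2r ?invr_gt0 ?ln2_gt0 //.
exact: xf.
Qed.

(** Both [p] and [q] are self-reciprocal up to the factor [u ^+ g], which reflects the exchange of
    the two parts. This carries the boundary case at infinity to the one at 0. *)
Lemma ln_objectiveV sigma mu u : (1 < g)%N -> 0 < u ->
  ln_objective g sigma mu u^-1 = ln_objective g sigma (1 - mu) u.
Proof.
move=> g1 u0; have u'0 : 0 < u^-1 by rewrite invr_gt0.
have lnug : ln u^-1 *+ g = - (g%:R * ln u).
  by rewrite lnV // mulNrn mulr_natl.
have pE : p.[u^-1] = p.[u] * u^-1 ^+ g.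
  rewrite -!pfunE /pfun !mulrBl mul1r -!exprMn mulfV ?lt0r_neq0 // expr1n.
  by rewrite mulrDl mul1r mulfV ?lt0r_neq0 // [u^-1 + 1]addrC; ring.
have qE : q.[u^-1] = q.[u] * u^-1 ^+ g.
  rewrite !horner_uncutE mulrDl mul1r -exprMn mulfV ?lt0r_neq0 // expr1n; ring.
rewrite /ln_objective pE qE !lnM ?posrE ?exprn_gt0 ?horner_cut_gt0
  ?horner_uncut_gt0 ?(ltW u0) // lnXn // lnug lnV ?posrE //.
by move: (ln p.[u]) (ln q.[u]) (ln u) => x y z; ring.
Qed.

(** With [p = 'X * p1] the multiples of [ln u] cancel, and the objective extends continuously to 0,
    where [p1] is [g] and [q] is 1. *)
Lemma ln_objective_boundary sigma mu l : (1 < g)%N -> sigma = g%:R * mu ->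
  (forall u, 0 < u -> l <= ln_objective g sigma mu u) -> l <= sigma * ln g%:R.
Proof.
move=> g1 sE lf; pose p1 : {poly R} := \poly_(j < g) p`_j.+1.
have pX : p = 'X * p1 by exact: cut_polyX.
pose h (u : R) : R := sigma * ln p1.[u] + (1 - sigma) * ln q.[u].
have p10 : p1.[0] = g%:R.
  by rewrite horner_coef0 coef_poly g_gt0 coef_cut_poly // g1 bin1.
have h0 : h 0 = sigma * ln g%:R.
  by rewrite /h p10 horner_uncutE expr0n gtn_eqF // addr0 ln1 mulr0 addr0.
rewrite -h0; apply: ge_at_right0 => [|u u0].
  have cln (P : {poly R}) : 0 < P.[0] -> {for 0, continuous (fun u => ln P.[u])}.
    move=> P0; apply: continuous_comp; last exact: continuous_ln.
    by apply/differentiable_continuous/derivable1_diffP; exact: derivable_horner.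
  apply: continuousD; apply: continuousM; first exact: cst_continuous.
  - by apply: cln; rewrite p10 ltr0n.
  - exact: cst_continuous.
  - by apply: cln; exact: horner_uncut_gt0.
have := lf u u0; suff -> : ln_objective g sigma mu u = h u by [].
have p1u : 0 < p1.[u].
  by have := horner_cut_gt0 g1 u0; rewrite pX hornerM hornerX pmulr_rgt0.
rewrite /ln_objective /h pX hornerM hornerX lnM ?posrE // sE.
by move: (ln p1.[u]) (ln q.[u]) (ln u) => x y z; ring.
Qed.

Lemma stationary_equation sigma mu u : 0 <= sigma <= 1 ->
  sigma <= g%:R * mu -> sigma <= g%:R * (1 - mu) -> 0 < u ->
  objective g sigma mu u = inf_objective sigma mu ->
  sigma * u * derive1 (pfun g) u * qfun g u
    + (1 - sigma) * u * pfun g u * derive1 (qfun g) u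
    = mu * g%:R * pfun g u * qfun g u.
Proof.
move=> s01 s0 s1 u0 uinf.
rewrite pfunE // qfunE // -!derivE.
have [g1|g1] := ltnP 1 g; last first.
  (* Here [p] is zero and both sides vanish. *)
  have -> : g = 1%N by lia.
  by rewrite cut_poly1 deriv0 !horner0; ring.
have nd : cut_nontrivial g sigma by rewrite /cut_nontrivial g1.
have umin v : 0 < v -> ln_objective g sigma mu u <= ln_objective g sigma mu v.
  move=> v0; apply: le_trans (inf_objective_le s01 nd s0 s1 v0).
  by rewrite -uinf objectiveE // mulfVK // lt0r_neq0 // ln2_gt0.
have := stationary_at_min nd u0 umin.
have := horner_cut_gt0 g1 u0; have := horner_uncut_gt0 g (ltW u0).
move: (q.[u]) (q^`().[u]) (p.[u]) (p^`().[u]) => Q Q' P P' Q0 P0 st.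
apply/eqP; rewrite -subr_eq0; apply/eqP.
have -> : sigma * u * P' * Q + (1 - sigma) * u * P * Q' - mu * g%:R * P * Q =
  (sigma * (P' / P) + (1 - sigma) * (Q' / Q) - mu * g%:R / u) * (u * P * Q).
  by field; rewrite !lt0r_neq0.
by rewrite st mul0r.
Qed.

End Infimum.

(** * Growth of coefficients and of the cutsize distribution *)

Section FourthRoot.
Variable R : realType.

(** The scale of the error terms: with [r] the fourth root of [n], logarithms of multiples of [n]
    are O(r) and the Chebyshev window is O(r^2), so all errors are O(r^3) = o(n). *)
Definition fourth_root (n : nat) : R := Num.sqrt (Num.sqrt n%:R).

Lemma fourth_root_ge1 n : (0 < n)%N -> 1 <= fourth_root n.
Proof.
have sqrt_ge1 (x : R) : 1 <= x -> 1 <= Num.sqrt x.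
  by move=> x1; rewrite -[leLHS]sqrtr1 ler_wsqrtr.
by move=> n0; apply/sqrt_ge1/sqrt_ge1; rewrite ler1n.
Qed.

Lemma sqr_fourth_root n : fourth_root n ^+ 2 = Num.sqrt n%:R.
Proof. by rewrite sqr_sqrtr // sqrtr_ge0. Qed.

Lemma fourth_rootK n : fourth_root n ^+ 4 = n%:R.
Proof. by rewrite -[4%N]/(2 * 2)%N exprM sqr_fourth_root sqr_sqrtr // ler0n. Qed.

Lemma ln_natM_le c n : (0 < c)%N -> (0 < n)%N ->
  ln (c * n)%:R <= (c%:R + 4) * fourth_root n.
Proof.
move=> c0 n0; have r1 := fourth_root_ge1 n0.
have r0 : 0 < fourth_root n by exact: lt_le_trans r1.
rewrite natrM lnM ?posrE ?ltr0n // -(fourth_rootK n) lnXn //.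
have lc : ln (c%:R : R) <= c%:R by apply/ltW/ln_sublinear; rewrite ltr0n.
have lr : ln (fourth_root n) <= fourth_root n by apply/ltW/ln_sublinear.
have c1 : 0 <= c%:R :> R by rewrite ler0n.
rewrite mulrDl lerD //; first by apply: le_trans lc _; rewrite ler_peMr.
by rewrite mulr_natl lerMn2r lr orbT.
Qed.

End FourthRoot.

Section Growth.
Variables (R : realType) (g : nat).
Hypothesis g_gt0 : (0 < g)%N.
Implicit Types (sigma mu u v x l : R).
Local Notation p := (cut_poly R g).
Local Notation q := (uncut_poly R g).
Local Notation F s n := (p ^+ s * q ^+ (n - s)).

Lemma cut_exp_ge0 s n : coef_le 0 (F s n).
Proof.
by apply: coef_le0M; apply: coef_le0X; [exact: coef_le0_cut|
  exact: coef_le0_uncut].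
Qed.

Lemma size_cut_exp s n : (s <= n)%N -> (size (F s n) <= (g * n).+1)%N.
Proof.
move=> sn; apply/leq_sizeP => j jN; apply/eqP; apply: contraTT jN.
move=> /(coef_support g_gt0); rewrite subnKC // -ltnNge ltnS => /andP[_ jn].
exact: leq_trans jn (leq_subr _ _).
Qed.

Lemma ln_horner_cut_exp sigma mu u n s k : cut_nontrivial g sigma -> 0 < u ->
  s%:R = sigma * n%:R -> k%:R = mu * g%:R * n%:R -> (0 < n)%N -> (s <= n)%N ->
  0 < (F s n).[u] /\
  ln (F s n).[u] - k%:R * ln u = n%:R * ln_objective g sigma mu u.
Proof.
move=> nd u0 sE kE n0 sn.
have q0 := horner_uncut_gt0 g (ltW u0).
have ps : 0 < p.[u] ^+ s /\ ln (p.[u] ^+ s) = s%:R * ln p.[u].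
  (* If a factor [p] occurs, then [sigma] is nonzero, so [1 < g] and [p] is positive at [u]. *)
  have [->|s0] := posnP s; first by rewrite expr0 ln1 mul0r.
  suff g1 : (1 < g)%N.
    by rewrite exprn_gt0 ?lnXn ?horner_cut_gt0 // mulr_natl.
  case/orP: nd => // /eqP s0'; move: sE; rewrite s0' mul0r => /eqP.
  by rewrite pnatr_eq0 => /eqP; lia.
have qt0 : 0 < q.[u] ^+ (n - s) by exact: exprn_gt0.
case: ps => ps0 lps; rewrite hornerM !horner_exp mulr_gt0 //; split=> //.
rewrite lnM ?posrE // lps lnXn // -[ln q.[u] *+ _]mulr_natr natrB //.
rewrite /ln_objective sE kE; move: (ln p.[u]) (ln q.[u]) => x y.
by ring.
Qed.

Lemma le_of_natM sigma n s : sigma <= 1 -> s%:R = sigma * n%:R -> (s <= n)%N.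
Proof. by move=> s1 sE; rewrite -(ler_nat R) sE ler_piMl. Qed.

Lemma cut_coef_upper sigma mu u n s k : cut_nontrivial g sigma -> sigma <= 1 ->
  0 < u ->
  s%:R = sigma * n%:R -> k%:R = mu * g%:R * n%:R -> (0 < n)%N ->
  (F s n)`_k != 0 -> ln (F s n)`_k <= n%:R * ln_objective g sigma mu u.
Proof.
move=> nd s1 u0 sE kE n0 Fk; have sn := le_of_natM s1 sE.
have [Fu <-] := ln_horner_cut_exp nd u0 sE kE n0 sn.
have Fk0 : 0 < (F s n)`_k.
  by rewrite lt_def Fk; have := cut_exp_ge0 s n k; rewrite coef0.
rewrite lerBrDr mulr_natl -lnXn // -lnM ?posrE ?exprn_gt0 //.
rewrite ler_ln_pos ?mulr_gt0 ?exprn_gt0 //.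
have kN : (k < size (F s n))%N by rewrite ltnNge;
  apply: contraNN Fk => /(nth_default 0) ->.
rewrite horner_coef (bigD1 (Ordinal kN)) //= lerDl.
apply: sumr_ge0 => i _; rewrite mulr_ge0 ?exprn_ge0 ?(ltW u0) //.
by have := cut_exp_ge0 s n i; rewrite coef0.
Qed.

Lemma cut_coef_lower sigma mu u : cut_nontrivial g sigma -> 0 <= sigma <= 1 ->
  0 < u ->
  sigma * (p^`().[u] / p.[u]) + (1 - sigma) * (q^`().[u] / q.[u])
    - mu * g%:R / u = 0 ->
  exists K : R, forall n s k : nat, (0 < n)%N -> s%:R = sigma * n%:R ->
    k%:R = mu * g%:R * n%:R -> regular_exponents g s -> (F s n)`_k != 0 ->
    n%:R * ln_objective g sigma mu u - K * fourth_root R n ^+ 3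
      <= ln (F s n)`_k.
Proof.
have le4 a : (0 < a)%N -> (2 * a.+1 <= 4 * a)%N by lia.
move=> nd /andP[sig0 sig1] u0 st.
have [bp mp] : exists b, moments p u ((euler_op p).[u] / p.[u]) b.
  have [g1|g1] := ltnP 1 g; last first.
    have g1' : g = 1%N by lia.
    by exists 0; rewrite g1' cut_poly1; exact: moments0.
  by apply: moments_ex; rewrite lt0r_neq0 // horner_cut_gt0.
have [bq mq] : exists b, moments q u ((euler_op q).[u] / q.[u]) b.
  by apply: moments_ex; rewrite lt0r_neq0 // horner_uncut_gt0 // ltW.
(* [B] bounds the variance per factor, [c * r ^+ 2] the window [D], and below [W * r] bounds
   [ln M + ln U], the cost of one step. *)
pose B := `|bp| + `|bq|; pose c := Num.sqrt (2 * B) + 1.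
pose U := Num.max u u^-1.
have uU : u <= U by rewrite le_max lexx.
have vU : u^-1 <= U by rewrite le_max lexx orbT.
have U1 : 1 <= U.
  have [u1|/ltW u1] := lerP 1 u; first exact: le_trans uU.
  by apply: le_trans vU; rewrite invf_ge1.
pose W := (step_bound g)%:R + 4 + ln U.
exists ((4 * g)%:R + 4 + c * W) => n s k n0 sE kE reg Fk.
have sn := le_of_natM sig1 sE.
have [Fu <-] := ln_horner_cut_exp nd u0 sE kE n0 sn.
have Fk0 : 0 < (F s n)`_k.
  by rewrite lt_def Fk; have := cut_exp_ge0 s n k; rewrite coef0.
have r1 := fourth_root_ge1 R n0.
set r := fourth_root R n in r1 *.
(* Rounding up gives [0 < D] and [D^2 >= 2 B n], at least twice the variance. *)
pose D := (Num.truncn (Num.sqrt (2 * B * n%:R))).+1.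
have sqB : Num.sqrt (2 * B * n%:R) = Num.sqrt (2 * B) * r ^+ 2.
  by rewrite sqrtrM ?mulr_ge0 ?addr_ge0 // sqr_fourth_root.
have Dge : Num.sqrt (2 * B * n%:R) <= D%:R by apply/ltW/truncnS_gt.
have Dle : D%:R <= c * r ^+ 2.
  rewrite -natr1 [c * _]mulrDl mul1r lerD //; last by rewrite exprn_ege1.
  by rewrite -sqB truncn_le // sqrtr_ge0.
have nsE : (n - s)%:R = (1 - sigma) * n%:R :> R by rewrite natrB // sE; ring.
have mF : moments (F s n) u k%:R (bp *+ s + bq *+ (n - s)).
  have -> : k%:R = (euler_op p).[u] / p.[u] *+ s
                   + (euler_op q).[u] / q.[u] *+ (n - s).
    (* Subtracting [u * n] times the stationarity equation turns the sum of the means into [k]. *)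
    rewrite -[RHS]addr0 -[in RHS](mulr0 (u * n%:R)) -[0 in RHS]oppr0 -st.
    rewrite !euler_opE !hornerM !hornerX.
    rewrite -[_ / p.[u] *+ s]mulr_natr -[_ / q.[u] *+ _]mulr_natr nsE sE kE.
    move: (p^`().[u]) (p.[u])^-1 (q^`().[u]) (q.[u])^-1 => P' P Q' Q.
    by field; rewrite lt0r_neq0.
  exact: momentsM (momentsX _ mp) (momentsX _ mq).
have bD : (bp *+ s + bq *+ (n - s)) * 2 <= D%:R ^+ 2.
  apply: (@le_trans _ _ (2 * B * n%:R)).
    have le_abs (b : R) j : (j <= n)%N -> b *+ j <= `|b| * n%:R.
      move=> jn; rewrite mulr_natr; apply: (@le_trans _ _ (`|b| *+ j)).
        by rewrite lerMn2r ler_norm orbT.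
      exact: ler_wpMn2l.
    have -> : 2 * B * n%:R = (`|bp| * n%:R + `|bq| * n%:R) * 2 by rewrite /B; ring.
    by rewrite ler_pM2r // lerD // le_abs // leq_subr.
  rewrite -[leLHS]sqr_sqrtr ?mulr_ge0 ?addr_ge0 //.
  by rewrite lerXn2r ?nnegrE ?sqrtr_ge0.
pose M : R := (step_bound g * n)%:R.
have M1 : 1 <= M by rewrite ler1n !muln_gt0 n0 !expn_gt0 g_gt0.
have low : (F s n).[u] <= 2 * (g * n).+1%:R * (M * U) ^+ D * ((F s n)`_k * u ^+ k).
  apply: (coef_lower _ u0 mF) => //.
  - by move=> i; have := cut_exp_ge0 s n i; rewrite coef0.
  - exact: size_cut_exp.
  - move=> i Fi; have := coef_ratio g_gt0 _ reg Fi Fk.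
    by rewrite subnKC //; apply.
have MU0 : 0 < M * U by rewrite mulr_gt0 // (lt_le_trans ltr01).
have N0 : 0 < 2 * (g * n).+1%:R :> R by rewrite mulr_gt0 // ltr0n.
have Uk : 0 < u ^+ k by exact: exprn_gt0.
have lnle : ln (F s n).[u] <= ln (2 * (g * n).+1%:R) + D%:R * (ln M + ln U)
    + (ln (F s n)`_k + k%:R * ln u).
  apply: (le_trans (ler_ln_pos Fu low)).
  have M0 : 0 < M by exact: lt_le_trans M1.
  have U0 : 0 < U by exact: lt_le_trans U1.
  have MUD : 0 < (M * U) ^+ D by exact: exprn_gt0.
  rewrite lnM ?posrE; [|exact: mulr_gt0|exact: mulr_gt0].
  rewrite [ln (2 * _ * _)]lnM ?posrE // [ln (_ ^+ D)]lnXn //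
    [ln (M * U)]lnM ?posrE //.
  by rewrite [ln (_ * u ^+ k)]lnM ?posrE // [ln (u ^+ k)]lnXn //
    [D%:R * _]mulr_natl [k%:R * _]mulr_natl.
have lnN : ln (2 * (g * n).+1%:R) <= ((4 * g)%:R + 4) * r ^+ 3.
  have gn1 : (0 < g * n)%N by rewrite muln_gt0 g_gt0.
  have N4 : 2 * (g * n).+1%:R <= (4 * g * n)%:R :> R.
    by rewrite -natrM ler_nat -mulnA le4.
  apply: (le_trans (ler_ln_pos N0 N4)); apply: (le_trans (ln_natM_le _ _ n0)).
    by rewrite muln_gt0.
  rewrite ler_wpM2l ?addr_ge0 ?ler0n // -/r -[leLHS]expr1.
  by rewrite ler_weXn2l.
have lnMU : D%:R * (ln M + ln U) <= c * W * r ^+ 3.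
  have lU : 0 <= ln U by exact: ln_ge0.
  have -> : c * W * r ^+ 3 = c * r ^+ 2 * (W * r) by ring.
  apply: ler_pM => //; first by rewrite addr_ge0 // ln_ge0.
  rewrite /W mulrDl lerD //; last by rewrite ler_peMr.
  by apply: ln_natM_le => //; rewrite muln_gt0 !expn_gt0 g_gt0.
rewrite [_ * r ^+ 3]mulrDl lerBlDr lerBlDr; apply: (le_trans lnle).
by rewrite [leRHS]addrAC [leRHS]addrC lerD2r lerD.
Qed.

End Growth.

(** * Binomial coefficients and entropy *)

Section Binomial.

(** The weight [k^i / i!] is largest at [i = k]: going from [i] to [i + 1] multiplies it by
    [k / (i + 1)]. *)
Lemma fact_pow_le k i : (k`! * k ^ i <= i`! * k ^ k)%N.
Proof.
have lo d : ((i + d)`! <= i`! * (i + d) ^ d)%N.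
  elim: d => [|d IH]; first by rewrite addn0 muln1.
  rewrite addnS factS expnS mulnCA leq_mul2l (leq_trans IH) ?orbT //.
  by rewrite leq_mul2l; case: d {IH} => [|d];
    rewrite ?expn0 ?leqnn ?leq_exp2r ?leqnSn ?orbT.
have up d : (k`! * k ^ d <= (k + d)`!)%N.
  elim: d => [|d IH]; first by rewrite addn0 muln1.
  by rewrite addnS factS expnS mulnCA leq_mul // ltnW // ltnS leq_addr.
have [/subnKC <-|/ltnW/subnKC <-] := leqP i k.
  by rewrite [in X in (_ <= X)%N]expnD [(_ ^ i * _)%N]mulnC mulnA leq_mul2r lo orbT.
by rewrite expnD [(k ^ k * _)%N]mulnC mulnA leq_mul2r up orbT.
Qed.

(** The binomial law with parameters [N] and [k / N] has mode [k]: multiply [fact_pow_le] for [k]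
    and for [N - k]. *)
Lemma bin_mode N k i : (k <= N)%N -> (i <= N)%N ->
  ('C(N, i) * (k ^ i * (N - k) ^ (N - i)) <=
   'C(N, k) * (k ^ k * (N - k) ^ (N - k)))%N.
Proof.
move=> kN iN.
have f0 a : (0 < a`!)%N := fact_gt0 a.
rewrite -(leq_pmul2r (f0 k)) -(leq_pmul2r (f0 (N - k)%N)).
rewrite -(leq_pmul2r (f0 i)) -(leq_pmul2r (f0 (N - i)%N)).
have := leq_mul (fact_pow_le k i) (fact_pow_le (N - k) (N - i)).
rewrite -(leq_pmul2l (f0 N)).
have bi := bin_fact iN; have bk := bin_fact kN.
rewrite -{1}bi -{1}bk.
by congr (_ <= _)%N; ring.
Qed.

Variable R : realType.
Implicit Type x : R.

(** At [k = 0] the convention [0 ^ 0 = 1] matches 0 log 0 = 0. *)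
Lemma xlnx_nat (k N : nat) x : (0 < N)%N -> k%:R = x * N%:R ->
  ln (k ^ k)%:R = k%:R * (ln x + ln N%:R).
Proof.
move=> N0 kE; have [->|k0] := posnP k; first by rewrite expn0 ln1 mul0r.
have x0 : 0 < x by rewrite -(pmulr_lgt0 _ (_ : 0 < N%:R)) -?kE ltr0n.
by rewrite natrX lnXn ?ltr0n // kE lnM ?posrE ?ltr0n // -kE mulr_natl.
Qed.

Definition ln_entropy x := - x * ln x - (1 - x) * ln (1 - x).

Lemma H2E x : H2 x = ln_entropy x / ln 2.
Proof. by rewrite /H2 /log2 /ln_entropy; ring. Qed.

(** Expand [N ^ N] as the power of [(N - k) + k]: the term of index [k] is the largest of [N + 1]
    terms, hence lies between [N ^ N / (N + 1)] and [N ^ N]. *)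
Lemma ln_bin_entropy (N k : nat) x : (0 < N)%N -> (k <= N)%N -> k%:R = x * N%:R ->
  `|ln 'C(N, k)%:R - N%:R * ln_entropy x| <= ln (N.+1)%:R.
Proof.
move=> N0 kN kE.
have kE' : (N - k)%:R = (1 - x) * N%:R by rewrite natrB // kE; ring.
have pow0 a : (0 < a ^ a)%N by case: a => // a; rewrite expn_gt0.
have C0 : (0 < 'C(N, k))%N by rewrite bin_gt0.
pose t i := ('C(N, i) * (k ^ i * (N - k) ^ (N - i)))%N.
have sum_t : (\sum_(i < N.+1) t i = N ^ N)%N.
  rewrite -[X in (X ^ _)%N](subnK kN) expnDn; apply: eq_bigr => i _.
  by rewrite /t [(k ^ i * _)%N]mulnC.
have up : (t k <= N ^ N)%N.
  by rewrite -sum_t (bigD1 (Ordinal (kN : (k < N.+1)%N))) //= leq_addr.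
have lo : (N ^ N <= N.+1 * t k)%N.
  rewrite -sum_t -[N.+1 in X in (_ <= X)%N]card_ord -sum_nat_const.
  by apply: leq_sum => i _; apply: bin_mode; rewrite // -ltnS.
have tk0 : (0 < t k)%N by rewrite !muln_gt0 C0 !pow0.
have lnt : ln (t k)%:R = ln 'C(N, k)%:R - N%:R * ln_entropy x + N%:R * ln N%:R :> R.
  rewrite /t !natrM !lnM ?posrE ?mulr_gt0 ?ltr0n //.
  rewrite (xlnx_nat N0 kE) (xlnx_nat N0 kE') kE kE' /ln_entropy; ring.
have lnNN : ln (N ^ N)%:R = N%:R * ln N%:R :> R.
  by rewrite natrX lnXn ?ltr0n // mulr_natl.
have {}up : ln (t k)%:R <= N%:R * ln N%:R :> R.
  by rewrite -lnNN ler_ln_pos ?ltr0n // ler_nat.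
have {}lo : N%:R * ln N%:R <= ln N.+1%:R + ln (t k)%:R :> R.
  by rewrite -lnNN -lnM ?posrE ?ltr0n // -natrM ler_ln_pos ?ltr0n // ler_nat.
have lnN0 : 0 <= ln N.+1%:R :> R by rewrite ln_ge0 // ler1n.
move: lnt up lo lnN0; rewrite ler_norml.
move: (ln (t k)%:R) (N%:R * ln N%:R) (ln 'C(N, k)%:R - _) (ln N.+1%:R) => a b c d.
move=> *; apply/andP; split; lra.
Qed.

End Binomial.

Section Growth.
Variables (R : realType) (g : nat).
Hypothesis g_gt0 : (0 < g)%N.
Implicit Types (sigma mu u v x l : R).
Local Notation p := (cut_poly R g).
Local Notation q := (uncut_poly R g).
Local Notation F s n := (p ^+ s * q ^+ (n - s)).

Lemma cut_coef_growth sigma mu : cut_nontrivial g sigma -> 0 <= sigma <= 1 ->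
  0 < mu < 1 -> sigma <= g%:R * mu -> sigma <= g%:R * (1 - mu) ->
  exists K : R, forall n s k : nat, (0 < n)%N -> s%:R = sigma * n%:R ->
    k%:R = mu * g%:R * n%:R -> regular_exponents g s -> (F s n)`_k != 0 ->
    `|ln (F s n)`_k - n%:R * (inf_objective g sigma mu * ln 2)|
      <= K * fourth_root R n ^+ 3.
Proof.
move=> nd s01 /andP[mu0 mu1] les lel; set L := _ * ln 2.
have /andP[sig0 sig1] := s01.
have upper n s k : (0 < n)%N -> s%:R = sigma * n%:R ->
    k%:R = mu * g%:R * n%:R -> (F s n)`_k != 0 -> ln (F s n)`_k <= n%:R * L.
  move=> n0 sE kE Fk; rewrite -ler_pdivrMl ?ltr0n //.
  apply: inf_objective_ge => u u0; rewrite ler_pdivrMl ?ltr0n //.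
  exact: cut_coef_upper.
suff [K lower] : exists K : R, forall n s k : nat, (0 < n)%N ->
    s%:R = sigma * n%:R -> k%:R = mu * g%:R * n%:R -> regular_exponents g s ->
    (F s n)`_k != 0 -> n%:R * L - K * fourth_root R n ^+ 3 <= ln (F s n)`_k.
  exists `|K| => n s k n0 sE kE reg Fk.
  have r0 : 0 <= fourth_root R n ^+ 3 by rewrite exprn_ge0 // sqrtr_ge0.
  have KK : K * fourth_root R n ^+ 3 <= `|K| * fourth_root R n ^+ 3.
    by rewrite ler_wpM2r // ler_norm.
  have := upper n s k n0 sE kE Fk; have := lower n s k n0 sE kE reg Fk.
  have K0 : 0 <= `|K| * fourth_root R n ^+ 3 by rewrite mulr_ge0.
  move: KK K0; move: (K * _) (`|K| * _) (ln _) (n%:R * L) => a b c d *.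
  by rewrite ler_norml; apply/andP; split; lra.
have Lle u : 0 < u -> L <= ln_objective g sigma mu u.
  exact: inf_objective_le.
have g1_of_sigma : 0 < sigma -> (1 < g)%N.
  by move=> sg; case/orP: nd => // /eqP s0; move: sg; rewrite s0 ltxx.
have gR : 0 < g%:R :> R by rewrite ltr0n.
have extreme n s i j : (1 < g)%N -> L <= sigma * ln g%:R -> (0 < n)%N ->
    s%:R = sigma * n%:R ->
    (0 < i < g)%N -> 'C(g, i) = g -> j \in [:: 0; g]%N ->
    n%:R * L <= ln (F s n)`_(i * s + j * (n - s)).
  move=> g1 Ls n0 sE ig Cg jg.
  apply: (@le_trans _ _ (ln (g ^ s)%:R)).
    by rewrite natrX lnXn ?ltr0n //
      -[ln _ *+ s]mulr_natl sE -mulrA [leRHS]mulrCA ler_wpM2l.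
  by apply: ler_ln_pos; [rewrite ltr0n expn_gt0 g_gt0|exact: coef_cut_monomial].
(* On this boundary [k = s] is the least exponent of [F], and the infimum is at most the limit at
   0. *)
have [e0|s0] := eqVneq sigma (g%:R * mu).
  have g1 : (1 < g)%N by apply: g1_of_sigma; rewrite e0 mulr_gt0.
  exists 0 => n s k n0 sE kE _ _; rewrite mul0r subr0.
  have -> : k = (1 * s + 0 * (n - s))%N.
    apply/eqP; rewrite mul1n mul0n addn0 -(eqr_nat R) kE sE e0.
    by apply/eqP; ring.
  apply: extreme; rewrite ?bin1 ?inE //.
  exact: (ln_objective_boundary g_gt0 g1 e0).
(* Here [k] is the greatest exponent, and reciprocity reduces the limit at infinity to the one at
   0. *)
have [e1|s1] := eqVneq sigma (g%:R * (1 - mu)).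
  have g1 : (1 < g)%N by apply: g1_of_sigma; rewrite e1 mulr_gt0 // subr_gt0.
  exists 0 => n s k n0 sE kE _ _; rewrite mul0r subr0.
  have sn := le_of_natM sig1 sE.
  have -> : k = (g.-1 * s + g * (n - s))%N.
    apply/eqP; rewrite -(eqr_nat R) natrD !natrM natrB // kE sE e1.
    by rewrite -subn1 natrB //; apply/eqP; ring.
  apply: extreme; rewrite ?inE ?eqxx ?orbT //; last 2 first.
  - by lia.
  - by rewrite -subn1 bin_sub ?bin1.
  apply: (ln_objective_boundary g_gt0 g1 e1) => u u0.
  by rewrite -ln_objectiveV //; apply: Lle; rewrite invr_gt0.
have [u u0 umin] : exists2 u, 0 < u &
    forall v, 0 < v -> ln_objective g sigma mu u <= ln_objective g sigma mu v.
  apply: ln_objective_min => //.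
    by rewrite mulrC lt_neqAle s0.
  by have := lt_neqAle sigma (g%:R * (1 - mu));
    rewrite s1 lel mulrBr mulr1 [mu * _]mulrC.
have [K lower] := cut_coef_lower g_gt0 nd s01 u0 (stationary_at_min nd u0 umin).
exists K => n s k n0 sE kE reg Fk; apply: le_trans (lower n s k n0 sE kE reg Fk).
by rewrite lerD2r ler_wpM2l ?Lle.
Qed.

End Growth.

Lemma cvg_within_fourth_root (R : realType) (D : set nat) (x : nat -> R) (l K : R)
    (N0 : nat) :
  (forall n, D n -> (N0 <= n)%N -> (0 < n)%N -> `|x n - l| <= K / fourth_root R n) ->
  x n @[n --> within D \oo] --> l.
Proof.
move=> xl; apply/cvgrPdist_le => e e0.
pose c := `|K| / e; have c0 : 0 <= c by rewrite divr_ge0 // ltW.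
(* From [N1] on the fourth root of [n] is at least [c]. *)
pose N1 := (Num.truncn (c ^+ 4)).+1.
exists (maxn N0 N1) => // n /=; rewrite geq_max => /andP[N0n N1n] Dn.
have n0 : (0 < n)%N by exact: leq_ltn_trans N1n.
have r0 : 0 < fourth_root R n by apply: lt_le_trans (fourth_root_ge1 R n0).
rewrite distrC; apply: le_trans (xl n Dn N0n n0) _.
rewrite ler_pdivrMr //; apply: le_trans (ler_norm K) _.
rewrite mulrC -ler_pdivrMr // -/c -(@ler_pXn2r _ 4) ?nnegrE ?(ltW r0) //.
rewrite fourth_rootK; apply: le_trans (_ : N1%:R <= _); last by rewrite ler_nat.
exact/ltW/truncnS_gt.
Qed.

(** * Passage to the growth rate *)

Section Main.
Variables (R : realType) (g delta : nat) (sigma mu : R).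
Hypotheses (g_gt0 : (0 < g)%N) (d_gt0 : (0 < delta)%N).
Hypotheses (hsigma : 0 <= sigma <= 1) (hmu : 0 < mu < 1).
Hypotheses (hsmall : sigma <= g%:R * mu) (hlarge : sigma <= g%:R * (1 - mu)).
Local Notation p := (cut_poly R g).
Local Notation q := (uncut_poly R g).
Local Notation F s n := (p ^+ s * q ^+ (n - s)).

Lemma scaled_distributionE n s m1 : (0 < n)%N -> (delta %| g * n)%N ->
  s%:R = sigma * n%:R -> m1%:R = mu * (nb_checks g delta n)%:R ->
  let m := nb_checks g delta n in
  [/\ (delta * m = g * n)%N, (0 < m1 < m)%N, (s <= n)%N,
      (delta * m1)%:R = mu * g%:R * n%:R
    & scaled_distribution g delta sigma mu n =
      'C(m, m1)%:R * 'C(n, s)%:R * (F s n)`_(delta * m1)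
      / 'C(g * n, delta * m1)%:R].
Proof.
move=> n0 dgn sE m1E m; have /andP[mu0 mu1] := hmu; have /andP[sg0 sg1] := hsigma.
have dm : (delta * m = g * n)%N by rewrite mulnC divnK.
have m0 : (0 < m)%N.
  by rewrite -(ltn_pmul2l d_gt0) muln0 dm muln_gt0 g_gt0.
have m1m : (0 < m1 < m)%N.
  rewrite -(ltr_nat R) -[(m1 < m)%N](ltr_nat R) m1E mulr_gt0 ?ltr0n //=.
  by rewrite gtr_pMl ?ltr0n.
split => //; first exact: (le_of_natM sg1 sE).
  by rewrite natrM m1E mulrCA -natrM dm natrM mulrA.
rewrite /scaled_distribution -/m -sE -m1E !natrK.
by rewrite cutsize_distributionE.
Qed.

Lemma growth_domainP n : (0 < n)%N -> growth_domain g delta sigma mu n ->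
  exists s m1, [/\ (delta %| g * n)%N, s%:R = sigma * n%:R,
    m1%:R = mu * (nb_checks g delta n)%:R
    & scaled_distribution g delta sigma mu n != 0].
Proof.
move=> n0 [dgn sN mN A0].
by exists (Num.truncn (sigma * n%:R)),
  (Num.truncn (mu * (nb_checks g delta n)%:R)); rewrite !truncnK.
Qed.

(** For [g = 1] no net can be cut: [p] is zero and the distribution vanishes unless [sigma = 0]. *)
Lemma growth_domain_nontrivial n : (0 < n)%N -> growth_domain g delta sigma mu n ->
  cut_nontrivial g sigma.
Proof.
move=> n0 Dn; have [s [m1 [dgn sE m1E A0]]] := growth_domainP n0 Dn.
have [_ _ _ _ AE] := scaled_distributionE n0 dgn sE m1E.
rewrite /cut_nontrivial; have [//|g1] := ltnP 1 g.
have g1' : g = 1%N by lia.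
apply: contraNT A0 => sg; rewrite AE.
have s0 : s != 0%N by rewrite -(pnatr_eq0 R) sE mulf_neq0 // pnatr_eq0 -lt0n.
by rewrite g1' cut_poly1 expr0n (negPf s0) mul0r coef0 mulr0 mul0r.
Qed.

Definition ln_growth_rate : R :=
  ln_entropy sigma - g%:R * ((delta%:R - 1) / delta%:R) * ln_entropy mu
  + inf_objective g sigma mu * ln 2.

Lemma ln_scaled_growth : exists (K : R) (N0 : nat), forall n,
  growth_domain g delta sigma mu n -> (N0 <= n)%N -> (0 < n)%N ->
  `|ln (scaled_distribution g delta sigma mu n) - n%:R * ln_growth_rate|
    <= K * fourth_root R n ^+ 3.
Proof.
have /andP[mu0 mu1] := hmu; have /andP[sg0 sg1] := hsigma.
have [nd|tr] := boolP (cut_nontrivial g sigma); last first.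
  exists 0, 0%N => n Dn _ n0.
  by rewrite (growth_domain_nontrivial n0 Dn) in tr.
have [K growth] := cut_coef_growth g_gt0 nd hsigma hmu hsmall hlarge.
(* Each of the three binomials contributes [2 g + 4], the coefficient contributes [K]. From the
   given length on, [s = sigma n] is at least 2 when [sigma > 0], as [regular_exponents]
   requires. *)
exists (3 * ((2 * g)%:R + 4) + K), (Num.truncn (2 / sigma)).+1 => n Dn N0n n0.
have [s [m1 [dgn sE m1E]]] := growth_domainP n0 Dn.
have [dm m1m sn kE ->] := scaled_distributionE n0 dgn sE m1E.
set m := nb_checks g delta n in m1E dm m1m *.
set k := (delta * m1)%N in kE *.
have kgn : (k <= g * n)%N.
  by rewrite -dm leq_mul2l ltnW ?orbT //; case/andP: m1m.
rewrite !mulf_eq0 !negb_or => /andP[/andP[_ Fk] _].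
have Fk0 : 0 < (F s n)`_k.
  by rewrite lt_def Fk; have := cut_exp_ge0 R g_gt0 s n k; rewrite coef0.
have reg : regular_exponents g s.
  rewrite /regular_exponents; have [->|s0] := posnP s; first by rewrite orbT.
  have sg : 0 < sigma.
    by rewrite lt_def sg0 andbT; apply: contraTneq s0 => s0;
       rewrite -leqNgt -(ler_nat R) sE s0 mul0r.
  have g1 : (1 < g)%N by case/orP: nd => // /eqP s0'; rewrite s0' ltxx in sg.
  have s2 : (1 < s)%N.
    rewrite -(ler_nat R) sE mulrC -ler_pdivrMr //;
      apply: le_trans (_ : (Num.truncn (2 / sigma)).+1%:R <= _).
      exact/ltW/truncnS_gt.
    by rewrite ler_nat.
  by rewrite s2 andbT orbA; case: (ltngtP g 2) g1 => //; lia.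
have r1 := fourth_root_ge1 R n0.
pose E := ((2 * g)%:R + 4) * fourth_root R n ^+ 3.
have lnE a : (a <= g * n)%N -> ln (a.+1)%:R <= E.
  move=> agn; apply: (@le_trans _ _ (ln (2 * g * n)%:R)).
    have gn0 : (0 < g * n)%N by rewrite muln_gt0 g_gt0.
    by apply: ler_ln_pos; rewrite ?ltr0n // ler_nat; lia.
  apply: (le_trans (ln_natM_le _ _ n0)); first by rewrite muln_gt0.
  rewrite /E ler_wpM2l ?addr_ge0 ?ler0n // -[leLHS]expr1.
  by rewrite ler_weXn2l.
have mgn : (m <= g * n)%N by rewrite -dm leq_pmull.
have ngn : (n <= g * n)%N by rewrite leq_pmull.
have m0 : (0 < m)%N by case/andP: m1m => m1_0; exact: ltn_trans.
have Cm := ln_bin_entropy m0 (ltnW (proj2 (andP m1m))) m1E.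
have Cn := ln_bin_entropy n0 sn sE.
have gn0 : (0 < g * n)%N by rewrite muln_gt0 g_gt0.
have kE' : k%:R = mu * (g * n)%:R :> R by rewrite kE natrM mulrA.
have Cgn := ln_bin_entropy gn0 kgn kE'.
have Gk := growth n s k n0 sE kE reg Fk.
have C0 a b : (b <= a)%N -> 0 < 'C(a, b)%:R :> R by rewrite ltr0n bin_gt0.
have m1m' : (m1 <= m)%N by case/andP: m1m => _ /ltnW.
rewrite ln_div ?posrE ?mulr_gt0 ?C0 // !lnM ?posrE ?mulr_gt0 ?C0 //.
have mE : m%:R = g%:R / delta%:R * n%:R :> R.
  apply: (mulfI (_ : delta%:R != 0)); first by rewrite pnatr_eq0 -lt0n.
  by rewrite -natrM dm natrM; field; rewrite pnatr_eq0 -lt0n.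
(* As [m = g n / delta], the entropies of [mu] from ['C(m, m1)] and ['C(g * n, k)] combine with the
   factor [- g (delta - 1) / delta]. *)
have -> : n%:R * ln_growth_rate = m%:R * ln_entropy mu + n%:R * ln_entropy sigma
   + n%:R * (inf_objective g sigma mu * ln 2) - (g * n)%:R * ln_entropy mu.
  by rewrite mE natrM /ln_growth_rate; field; rewrite pnatr_eq0 -lt0n.
have -> : (3 * ((2 * g)%:R + 4) + K) * fourth_root R n ^+ 3 =
  E + E + E + K * fourth_root R n ^+ 3 by rewrite /E; ring.
have {}Cm := le_trans Cm (lnE _ mgn).
have {}Cn := le_trans Cn (lnE _ ngn).
have {}Cgn := le_trans Cgn (lnE _ (leqnn _)).
move: Cm Cn Cgn Gk; rewrite !ler_norml.
move: (ln 'C(m, m1)%:R) (m%:R * _) (ln 'C(n, s)%:R) (n%:R * ln_entropy _)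
  (ln (F s n)`_k) (n%:R * (_ * _)) (ln 'C(g * n, k)%:R) ((g * n)%:R * _) (E)
  (K * _) => a1 a2 b1 b2 c1 c2 d1 d2 e f.
by move=> /andP[? ?] /andP[? ?] /andP[? ?] /andP[? ?]; apply/andP; split; lra.
Qed.

Lemma growth_rate : is_growth_rate g delta sigma mu
  (H2 sigma - g%:R * ((delta%:R - 1) / delta%:R) * H2 mu
   + inf_objective g sigma mu).
Proof.
have [K [N0 growth]] := ln_scaled_growth.
apply: (@cvg_within_fourth_root _ _ _ _ (K / ln 2) N0) => n Dn N0n n0.
have ln20 := ln2_gt0 R; have r0 : 0 < fourth_root R n.
  by apply: lt_le_trans (fourth_root_ge1 R n0).
have nr0 : 0 < n%:R :> R by rewrite ltr0n.
have -> : n%:R^-1 * log2 (scaled_distribution g delta sigma mu n) -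
  (H2 sigma - g%:R * ((delta%:R - 1) / delta%:R) * H2 mu
   + inf_objective g sigma mu) =
  (ln (scaled_distribution g delta sigma mu n) - n%:R * ln_growth_rate)
   / (n%:R * ln 2).
  rewrite /log2 !H2E /ln_growth_rate.
  move: (ln (scaled_distribution _ _ _ _ _)) (ln 2) ln20 => a b b0.
  by field; rewrite !lt0r_neq0 ?ltr0n.
rewrite normrM normfV [`|n%:R * _|]gtr0_norm ?mulr_gt0 //.
rewrite ler_pdivrMr ?mulr_gt0 //; apply: le_trans (growth n Dn N0n n0) _.
rewrite -(fourth_rootK R n); move: (fourth_root R n) (ln 2) r0 ln20 => r b r0 b0.
rewrite le_eqVlt; apply/orP; left; apply/eqP.
by field; rewrite !lt0r_neq0.
Qed.

Lemma ratr_natM (x : R) : 0 <= x -> range (@ratr R) x ->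
  exists c d : nat, (0 < d)%N /\ x * d%:R = c%:R.
Proof.
move=> x0 [a _ ax]; have a0 : 0 <= a by rewrite -(ler0q R) ax.
exists `|numq a|%N, `|denq a|%N; split; first by rewrite absz_gt0 denq_neq0.
rewrite -ax /ratr !natr_absz !ger0_norm ?denq_ge0 ?numq_ge0 // mulfVK //.
by rewrite intr_eq0 denq_neq0.
Qed.

(** Multiples of [delta] and of the denominators of [sigma] and [mu] make all arguments integral; it
    remains to see that the coefficient of degree [k] is nonzero. *)
Lemma growth_domain_infinite (N : nat) : (1 < g)%N ->
  range (@ratr R) sigma -> range (@ratr R) mu ->
  exists2 n : nat, (N <= n)%N & growth_domain g delta sigma mu n.
Proof.
move=> g1 rs rm; have /andP[mu0 mu1] := hmu; have /andP[sg0 sg1] := hsigma.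
have [c1 [d1 [d10 sE]]] := ratr_natM sg0 rs.
have [c2 [d2 [d20 mE]]] := ratr_natM (ltW mu0) rm.
(* The factor 2 makes [s] even, which removes the parity obstruction for [g = 2], and makes a
   nonzero [s] at least 2, as [coef_gt0] requires. *)
pose a := (N.+1 * 2)%N; pose n := (a * delta * d1 * d2)%N.
have n0 : (0 < n)%N by rewrite !muln_gt0 d_gt0 d10 d20.
have a_gt0 : (0 < a * d2 * delta * d1)%N by rewrite !muln_gt0 d_gt0 d10 d20.
exists n; first by rewrite /n /a; nia.
have dgn : (delta %| g * n)%N.
  by rewrite (_ : g * n = delta * (g * (a * d1 * d2)))%N ?dvdn_mulr // /n; ring.
pose s := (c1 * (a * delta * d2))%N.
have sE' : s%:R = sigma * n%:R by rewrite /s /n !natrM -sE; ring.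
have nbE : nb_checks g delta n = (g * (a * d1 * d2))%N.
  rewrite /nb_checks (_ : (g * n = g * (a * d1 * d2) * delta)%N) ?mulnK //.
  by rewrite /n; ring.
pose m1 := (c2 * (g * (a * d1)))%N.
have m1E : m1%:R = mu * (nb_checks g delta n)%:R.
  by rewrite nbE /m1 !natrM -mE; ring.
have [dm m1m sn kE AE] := scaled_distributionE n0 dgn sE' m1E.
split => //; first by rewrite -sE' natr_nat.
  by rewrite -m1E natr_nat.
rewrite AE; have C0 x y : (y <= x)%N -> 'C(x, y)%:R != 0 :> R.
  by rewrite pnatr_eq0 -lt0n bin_gt0.
have kgn : (delta * m1 <= g * n)%N.
  by rewrite -dm leq_mul2l ltnW ?orbT //; case/andP: m1m.
rewrite !mulf_eq0 invr_eq0 !(negPf (C0 _ _ _)) ?orbF //=; last first.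
  by case/andP: m1m => _ /ltnW.
set k := (delta * m1)%N in kE kgn *.
(* The two inequalities on [sigma] say that [k] lies in the range of exponents of [F]. *)
have sk : (s <= k)%N.
  rewrite -(ler_nat R) sE' kE ler_wpM2r // mulrC //.
have kgs : (k <= g * n - s)%N.
  rewrite leq_subRL; last by rewrite (leq_trans sn) // leq_pmull.
  rewrite -(ler_nat R) natrD sE' kE [(g * n)%:R]natrM -mulrDl ler_wpM2r //.
  by move: hlarge; rewrite mulrBr mulr1 [mu * _]mulrC; lra.
have [lat|nlat] := boolP ((g == 2) || (s == 0%N)).
  rewrite coef_lattice // sk /=.
  have gk : (g %| k)%N.
    by apply/dvdn_mull/dvdn_mull/dvdn_mulr/dvdnn.
  have gs : (g %| s)%N.
    case/orP: lat => [/eqP ->|/eqP ->]; last exact: dvdn0.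
    by rewrite (_ : s = 2 * (c1 * (N.+1 * delta * d2)))%N ?dvdn_mulr // /s /a; ring.
  rewrite dvdn_sub // -mulr_natr mulf_neq0 //.
    rewrite C0 // -(leq_pmul2r g_gt0) divnK ?dvdn_sub // mulnBl.
    by case/orP: lat kgs => /eqP ->; lia.
  by rewrite pnatr_eq0 -lt0n expn_gt0 g_gt0.
have [g2 s0] : (2 < g)%N /\ (s != 0)%N.
  by move: nlat; rewrite negb_or => /andP[g2 s0]; split=> //; lia.
rewrite lt0r_neq0 // coef_gt0 //; first by rewrite /s /a in s0 *; nia.
by rewrite subnKC // sk.
Qed.

End Main.

Theorem theorem2 (R : realType) (gamma delta : nat) (sigma mu1 : R)
    (hgamma : (0 < gamma)%N) (hdelta : (0 < delta)%N)
    (hsigma : 0 <= sigma <= 1) (hmu1 : 0 < mu1 < 1)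
    (hsmall : sigma <= gamma%:R * mu1)
    (hlarge : sigma <= gamma%:R * (1 - mu1)) :
  let infimum := inf [set objective gamma sigma mu1 u | u in [set u : R | 0 < u]] in
  [/\ is_growth_rate gamma delta sigma mu1
        (H2 sigma - gamma%:R * ((delta%:R - 1) / delta%:R) * H2 mu1 + infimum),
      (* the limit is over infinitely many lengths *)
      ((1 < gamma)%N -> range (@ratr R) sigma -> range (@ratr R) mu1 ->
        forall N : nat, exists2 n : nat,
          (N <= n)%N & growth_domain gamma delta sigma mu1 n)
    & forall u : R, 0 < u -> objective gamma sigma mu1 u = infimum ->
        sigma * u * derive1 (pfun gamma) u * qfun gamma u
        + (1 - sigma) * u * pfun gamma u * derive1 (qfun gamma) u
        = mu1 * gamma%:R * pfun gamma u * qfun gamma u].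
Proof.
move=> infimum; split.
- exact: growth_rate.
- by move=> g1 rs rm N; exact: growth_domain_infinite.
- by move=> u u0 uinf; exact: stationary_equation uinf.
Qed.
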